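(* Let $\mathbb{G}$ be a homogeneous group with homogeneous dimension $Q$ equipped with a quasi-norm $|\cdot|$, and let $0<p\le q<\infty$. Suppose that $u$ and $v$ are two positive weight functions on $\mathbb{G}$. Then there exists a positive constant $C$ such that, for all positive functions $f$ on $\mathbb{G}$, the inequality $$\left(\int_{\mathbb{G}}\left[\exp\left(\frac{1}{|\mathbb{B}(0,|x|)|}\int_{\mathbb{B}(0,|x|)}\log f(y)\,dy\right)\right]^q u(x)\,dx\right)^{\frac1q}\le C\left(\int_{\mathbb{G}}f^p(x)\,v(x)\,dx\right)^{\frac1p}$$ holds, provided that $$D_Q:=\sup_{x\in\mathbb{G}}|\mathbb{B}(0,|x|)|^{\frac1q-\frac1p}\,u_1^{\frac1q}(x)\left[\exp\left(\frac{1}{|\mathbb{B}(0,|x|)|}\int_{\mathbb{B}(0,|x|)}\log\frac{1}{v(y)}\,dy\right)\right]^{\frac1p}<\infty,$$ where $u_1$ is the spherical average of $u$, $$u_1(x):=\frac{1}{|\mathfrak{S}|}\int_{\mathfrak{S}}u(|x|\sigma)\,d\sigma .$$ Moreover, the optimal constant $C$ in the inequality satisfies $$0<C\le\left(\frac pq\right)^{\frac1q}e^{\frac1p}\,D_Q .$$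
   Context: A homogeneous group $\mathbb{G}$ is a Lie group identified with $(\mathbb{R}^N,\circ)$ equipped with dilations $D_\lambda(x)=(\lambda^{v_1}x_1,\dots,\lambda^{v_N}x_N)$, $v_1,\dots,v_N>0$, which are automorphisms of the group for every $\lambda>0$; one writes $\lambda x$ for $D_\lambda(x)$. Its homogeneous dimension is $Q=v_1+\dots+v_N$. The Haar measure $dx$ is Lebesgue measure on $\mathbb{R}^N$, and $|\omega|$ denotes the Haar measure of a measurable set $\omega\subset\mathbb{G}$. A quasi-norm is a continuous function $|\cdot|:\mathbb{G}\to[0,\infty)$ with $|x^{-1}|=|x|$ for all $x$, $|\lambda x|=\lambda|x|$ for all $x$ and $\lambda>0$, and $|x|=0$ if and only if $x=0$. $\mathbb{B}(0,r)$ is the quasi-ball $\{y\in\mathbb{G}:|y|<r\}$. $\mathfrak{S}=\{x\in\mathbb{G}:|x|=1\}$ is the unit sphere, carrying the unique Radon measure $\sigma$ such that $\int_{\mathbb{G}}f(x)\,dx=\int_0^\infty\int_{\mathfrak{S}}f(ry)\,r^{Q-1}\,d\sigma(y)\,dr$ for all $f\in L^1(\mathbb{G})$; $|\mathfrak{S}|$ denotes $\sigma(\mathfrak{S})$, and in integrals over $\mathfrak{S}$ the point of integration is also written $\sigma$. One has $|\mathbb{B}(0,|x|)|=|x|^Q|\mathfrak{S}|/Q$. The optimal constant is the least $C$ for which the inequality holds for all positive functions $f$.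
   Formalization: The existence of the optimal (least) constant is asserted only when D_Q > 0; if D_Q = 0 (e.g. v(x) = exp(|x|^{-Q})) every C > 0 works, no least constant exists, and the stated bound 0 < C ≤ (p/q)^{1/q} e^{1/p} D_Q would be contradictory. *)

(* Defs.v *)
From HB Require Import structures.
From mathcomp Require Import all_boot all_order all_algebra.
From mathcomp Require Import all_classical all_reals all_analysis.

Set Implicit Arguments.
Unset Strict Implicit.
Unset Printing Implicit Defensive.

Import Order.TTheory GRing.Theory Num.Theory.
Import numFieldNormedType.Exports.

Local Open Scope classical_set_scope.
Local Open Scope ring_scope.

(* As for [n.-tuple T] in the library: the sigma-algebra generated by the
   coordinate functions. On R^N these are the Borel sets. *)
Section measurable_rV.
Context {d} {T : sigmaRingType d} (n : nat).

Let coors : 'I_n -> 'rV[T]_n -> T := fun i x => x ord0 i.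

Let rV_set0 : g_sigma_preimage coors set0.
Proof. exact: sigma_algebra0. Qed.

Let rV_setC A : g_sigma_preimage coors A -> g_sigma_preimage coors (~` A).
Proof. exact: sigma_algebraC. Qed.

Let rV_bigcup (F : (set 'rV[T]_n)^nat) :
  (forall i, g_sigma_preimage coors (F i)) ->
  g_sigma_preimage coors (\bigcup_i (F i)).
Proof. exact: sigma_algebra_bigcup. Qed.

HB.instance Definition _ := @isMeasurable.Build (measure_tuple_display d)
  'rV[T]_n (g_sigma_preimage coors) rV_set0 rV_setC rV_bigcup.

End measurable_rV.

Lemma measurable_fun_rVP d1 d2 (T1 : measurableType d1)
    (T2 : measurableType d2) n (f : T1 -> 'rV[T2]_n) :
  (forall i, measurable_fun setT (fun x => f x ord0 i)) ->
  measurable_fun setT f.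
Proof.
move=> mf _ A mA; rewrite setTI.
have : <<s \big[setU/set0]_(i < n)
    preimage_set_system setT (fun x : 'rV[T2]_n => x ord0 i) measurable >> A.
  exact: mA.
suff sub : <<s \big[setU/set0]_(i < n)
    preimage_set_system setT (fun x : 'rV[T2]_n => x ord0 i) measurable >>
    `<=` [set B | measurable (f @^-1` B)] by move=> /sub.
apply: smallest_sub.
  split=> /=.
  - by rewrite preimage_set0.
  - move=> B mB; rewrite setTD preimage_setC; exact: measurableC.
  - by move=> F mF; rewrite preimage_bigcup; exact: bigcup_measurable.
apply: (big_ind (fun X => X `<=` [set B | measurable (f @^-1` B)])).
- by [].
- by move=> X Y sX sY B [/sX|/sY].
- move=> i _ _ [B mB <-] /=.
  have := mf i measurableT B mB.
  by rewrite !setTI.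
Qed.

Lemma measurable_rV_coord d (T : measurableType d) n (i : 'I_n) :
  measurable_fun setT (fun x : 'rV[T]_n => x ord0 i).
Proof.
move=> _ Y mY; rewrite setTI; apply: sub_sigma_algebra => /=.
rewrite -bigcup_seq/=; exists i => /=; first by rewrite mem_index_enum.
by exists Y => //; rewrite setTI.
Qed.

Lemma sigma_finite_pushforward d1 d2 (T1 : measurableType d1)
    (T2 : measurableType d2) (R : realType)
    (m : set T1 -> \bar R) (f : T1 -> T2) (g : T2 -> T1) :
  sigma_finite setT m -> measurable_fun setT g -> cancel f g ->
  sigma_finite setT (pushforward m f).
Proof.
move=> [F FT mF] mg fK.
exists (fun k => g @^-1` F k); first by rewrite -preimage_bigcup -FT.
move=> k; have [mFk Fkoo] := mF k; split.
  by rewrite -[X in measurable X]setTI; exact: mg.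
rewrite /pushforward; suff -> : f @^-1` (g @^-1` F k) = F k by [].
by apply/seteqP; split => x /=; rewrite fK.
Qed.

Lemma sigma_finite_product_measure1 d1 d2 (T1 : measurableType d1)
    (T2 : measurableType d2) (R : realType)
    (m1 : {sigma_finite_measure set T1 -> \bar R})
    (m2 : {sigma_finite_measure set T2 -> \bar R}) :
  sigma_finite setT (m1 \x m2)%E.
Proof.
have /sigma_finiteP[F [TF ndF Foo]] := sigma_finiteT m1.
have /sigma_finiteP[G [TG ndG Goo]] := sigma_finiteT m2.
exists (fun n => F n `*` G n).
  rewrite -setXTT TF TG predeqE => -[x y]; split.
    move=> [/= [n _ Fnx] [k _ Gky]]; exists (maxn n k) => //; split.
    - by move: x Fnx; exact/subsetPset/ndF/leq_maxl.
    - by move: y Gky; exact/subsetPset/ndG/leq_maxr.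
  by move=> [n _ []/= ? ?]; split; exists n.
move=> k; have [? ?] := Foo k; have [? ?] := Goo k.
split; first exact: measurableX.
by rewrite product_measure1E// lte_mul_pinfty// ge0_fin_numE.
Qed.

Section tuple_power.
Context {R : realType} {d} {T : measurableType d}.

Definition tcons n (x : T * n.-tuple T) : n.+1.-tuple T :=
  [tuple of x.1 :: x.2].

Definition tuncons n (x : n.+1.-tuple T) : T * n.-tuple T :=
  (thead x, [tuple of behead x]).

Lemma measurable_tcons n : measurable_fun setT (@tcons n).
Proof. exact: measurable_cons. Qed.

Lemma measurable_tuncons n : measurable_fun setT (@tuncons n).
Proof.
apply/measurable_fun_pairP; split => /=.
- exact: measurable_tnth.
- exact: measurable_behead.
Qed.

Lemma tconsK n : cancel (@tcons n) (@tuncons n).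
Proof. by case=> x t; congr pair; apply/val_inj. Qed.

Section step.
Variables (m1 : {sigma_finite_measure set T -> \bar R}) (n : nat)
  (m : {sigma_finite_measure set (n.-tuple T) -> \bar R}).

Definition tuple_measure_step : set (n.+1.-tuple T) -> \bar R :=
  pushforward (m1 \x m)%E (@tcons n).

HB.instance Definition _ := Measure.copy tuple_measure_step
  (measure_function_pushforward__canonical__measure_function_Measure
    (m1 \x m)%E (@measurable_tcons n)).

Lemma sigma_finite_tuple_measure_step : sigma_finite setT tuple_measure_step.
Proof.
apply: (sigma_finite_pushforward _ (@measurable_tuncons n) (@tconsK n)).
exact: sigma_finite_product_measure1.
Qed.

HB.instance Definition _ := @Measure_isSigmaFinite.Build _ _ _
  tuple_measure_step sigma_finite_tuple_measure_step.

End step.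

Fixpoint tuple_measure (m1 : {sigma_finite_measure set T -> \bar R}) n :
    {sigma_finite_measure set (n.-tuple T) -> \bar R} :=
  if n is n'.+1 then tuple_measure_step m1 (tuple_measure m1 n')
  else \d_ [tuple].

Lemma tuple_measure_box (m1 : {sigma_finite_measure set T -> \bar R}) n
    (A : 'I_n -> set T) : (forall i, measurable (A i)) ->
  tuple_measure m1 n [set t | forall i, A i (tnth t i)] =
  (\prod_(i < n) m1 (A i))%E.
Proof.
elim: n A => [|n IH] A mA.
  by rewrite big_ord0 /= diracE mem_set// => -[].
rewrite big_ord_recl -IH; last by move=> i; exact: mA.
rewrite /= /tuple_measure_step /pushforward -product_measure1E//; last first.
  rewrite (_ : mkset _ =
      \bigcap_(i in [set: 'I_n])
        ((fun t : n.-tuple T => tnth t i) @^-1` A (lift ord0 i))); last first.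
    by apply/seteqP; split => [t At i _|t At i]; [exact: At|exact: (At i)].
  apply: fin_bigcap_measurable => // i _.
  by rewrite -[X in measurable X]setTI; exact: measurable_tnth.
congr (_ _); apply/seteqP; split => -[x t] /=.
- move=> H; split; first exact: (H ord0).
  by move=> i /=; have := H (lift ord0 i); rewrite tnthS.
- move=> [Ax At] i; case: (unliftP ord0 i) => [j ->|->]; last exact: Ax.
  by rewrite tnthS; exact: At.
Qed.

Definition rV_of_tuple n (t : n.-tuple T) : 'rV[T]_n := \row_i tnth t i.

Definition tuple_of_rV n (x : 'rV[T]_n) : n.-tuple T := [tuple x ord0 i | i < n].

Lemma measurable_rV_of_tuple n : measurable_fun setT (@rV_of_tuple n).
Proof.
apply: measurable_fun_rVP => i; under eq_fun do rewrite mxE.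
exact: measurable_tnth.
Qed.

Lemma measurable_tuple_of_rV n : measurable_fun setT (@tuple_of_rV n).
Proof.
apply/measurable_fun_tnthP => i; rewrite /comp.
under eq_fun do rewrite tnth_mktuple.
exact: measurable_rV_coord.
Qed.

Lemma rV_of_tupleK n : cancel (@rV_of_tuple n) (@tuple_of_rV n).
Proof. by move=> t; apply: eq_from_tnth => i; rewrite tnth_mktuple mxE. Qed.

Definition rV_measure (m1 : {sigma_finite_measure set T -> \bar R}) n :
  set 'rV[T]_n -> \bar R := pushforward (tuple_measure m1 n) (@rV_of_tuple n).
Local Arguments rV_measure m1 n _ : clear implicits.

HB.instance Definition _ m1 n := Measure.copy (rV_measure m1 n)
  (measure_function_pushforward__canonical__measure_function_Measure
    (tuple_measure m1 n) (@measurable_rV_of_tuple n)).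

Lemma sigma_finite_rV_measure m1 n : sigma_finite setT (rV_measure m1 n).
Proof.
apply: (sigma_finite_pushforward _ (@measurable_tuple_of_rV n)
  (@rV_of_tupleK n)).
exact: sigma_finiteT.
Qed.

HB.instance Definition _ m1 n := @Measure_isSigmaFinite.Build _ _ _
  (rV_measure m1 n) (sigma_finite_rV_measure m1 n).

End tuple_power.
Arguments rV_measure {R d T} m1 n _.

(* [lebesgue_measure] seen on the canonical measurableType structure of [R],
   whose display differs from that of [measurableTypeR R]. *)
Definition lebesgue_R (R : realType) : set R -> \bar R := @lebesgue_measure R.

HB.instance Definition _ (R : realType) := @isMeasure.Build _ R R
  (@lebesgue_R R) (measure0 (@lebesgue_measure R))
  (@measure_ge0 _ _ _ (@lebesgue_measure R))
  (@measure_semi_sigma_additive _ _ _ (@lebesgue_measure R)).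

HB.instance Definition _ (R : realType) := @Measure_isSigmaFinite.Build _ R R
  (@lebesgue_R R) (@sigma_finiteT _ _ _ (@lebesgue_measure R)).

Definition lebesgue_rV (R : realType) (n : nat) : set 'rV[R]_n -> \bar R :=
  rV_measure (@lebesgue_R R) n.
Arguments lebesgue_rV R n _ : clear implicits.

HB.instance Definition _ (R : realType) n :=
  SigmaFiniteMeasure.on (lebesgue_rV R n).

Lemma lebesgue_rV_box (R : realType) n (a b : 'rV[R]_n) :
  (forall i, a ord0 i <= b ord0 i) ->
  lebesgue_rV R n [set x : 'rV[R]_n |
    forall i, a ord0 i <= x ord0 i <= b ord0 i] =
  (\prod_(i < n) (b ord0 i - a ord0 i))%:E.
Proof.
move=> ab.
transitivity (\prod_(i < n) lebesgue_R `[a ord0 i, b ord0 i])%E; last first.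
  rewrite -prodEFin; apply: eq_bigr => i _.
  rewrite /lebesgue_R lebesgue_measure_itv/= lte_fin.
  by case: ltgtP (ab i) => // ->; rewrite subrr.
have <- := @tuple_measure_box R _ _ (@lebesgue_R R) n
  (fun i => [set` `[a ord0 i, b ord0 i]])
  (fun i => measurable_itv `[a ord0 i, b ord0 i]).
rewrite /lebesgue_rV /rV_measure /pushforward.
by congr (_ _); apply/seteqP; split => t /= At i; have := At i;
  rewrite mxE /= in_itv.
Qed.

Fixpoint is_Ck (R : realType) (V W : normedModType R) (k : nat) (f : V -> W) :
    Prop :=
  if k is k'.+1 then
    (forall x, differentiable f x) /\ (forall h, is_Ck k' (fun x => 'D_h f x))
  else continuous f.

Definition is_smooth (R : realType) (V W : normedModType R) (f : V -> W) :
  Prop := forall k, is_Ck k f.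

Definition dilate (R : realType) (N : nat) (w : 'I_N -> R) (lam : R)
  (x : 'rV[R]_N) : 'rV[R]_N := \row_i (lam `^ w i * x ord0 i).

(* The group law, unit and inverse are those of a Lie group on R^N; dilations
   being automorphisms forces [hg_one = 0]. *)
Record homogeneous_group (R : realType) (N : nat) := HomogeneousGroup {
  hg_mul : 'rV[R]_N -> 'rV[R]_N -> 'rV[R]_N;
  hg_one : 'rV[R]_N;
  hg_inv : 'rV[R]_N -> 'rV[R]_N;
  hg_weight : 'I_N -> R;
  hg_mulA : associative hg_mul;
  hg_mul1x : left_id hg_one hg_mul;
  hg_mulx1 : right_id hg_one hg_mul;
  hg_mulVx : left_inverse hg_one hg_inv hg_mul;
  hg_mulxV : right_inverse hg_one hg_inv hg_mul;
  hg_mul_smooth :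
    is_smooth (fun z : 'rV[R]_N * 'rV[R]_N => hg_mul z.1 z.2);
  hg_inv_smooth : is_smooth hg_inv;
  hg_weight_gt0 : forall i, 0 < hg_weight i;
  hg_dilateM : forall lam, 0 < lam ->
    {morph dilate hg_weight lam : x y / hg_mul x y}
}.

Section homogeneous_group_theory.
Context {R : realType} {N : nat} (G : homogeneous_group R N).

Definition dil (lam : R) (x : 'rV[R]_N) : 'rV[R]_N :=
  dilate (hg_weight G) lam x.

Definition homogeneous_dim : R := \sum_(i < N) hg_weight G i.

Record quasi_norm := QuasiNorm {
  qn :> 'rV[R]_N -> R;
  qn_continuous : continuous qn;
  qn_ge0 : forall x, 0 <= qn x;
  qn_inv : forall x, qn (hg_inv G x) = qn x;
  qn_dil : forall lam x, 0 < lam -> qn (dil lam x) = lam * qn x;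
  qn_eq0 : forall x, qn x = 0 <-> x = 0
}.

Variable nrm : quasi_norm.

Definition qball (r : R) : set 'rV[R]_N := [set y | nrm y < r].

Definition qsphere : set 'rV[R]_N := [set x | nrm x = 1].

(* The Radon measure of the polar decomposition, as a measure on R^N
   concentrated on the (compact) unit sphere, where Radon amounts to finite. *)
Definition polar_measure (sigma : {measure set 'rV[R]_N -> \bar R}) : Prop :=
  [/\ sigma (~` qsphere) = 0%E,
      (sigma qsphere < +oo)%E &
      forall f : 'rV[R]_N -> R,
        (lebesgue_rV R N).-integrable setT (EFin \o f) ->
        (\int[lebesgue_rV R N]_x (f x)%:E =
         \int[lebesgue_measure]_(r in `]0%R, +oo[)
           \int[sigma]_(y in qsphere)
             (f (dil r y) * r `^ (homogeneous_dim - 1))%:E)%E].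

Local Open Scope ereal_scope.

Definition mean_qball (g : 'rV[R]_N -> R) (r : R) : \bar R :=
  (fine (lebesgue_rV R N (qball r)))^-1%:E *
  \int[lebesgue_rV R N]_(y in qball r) (g y)%:E.

(* exp (1/|B(0,|x|)| \int_{B(0,|x|)} log f); the inner integral is
   extended-real valued, [expeR -oo = 0], [expeR +oo = +oo] *)
Definition geometric_mean (f : 'rV[R]_N -> R) (x : 'rV[R]_N) : \bar R :=
  expeR (mean_qball (fun y => ln (f y)) (nrm x)).

Definition spherical_mean (sigma : set 'rV[R]_N -> \bar R)
    (u : 'rV[R]_N -> R) (x : 'rV[R]_N) : \bar R :=
  (fine (sigma qsphere))^-1%:E *
  \int[sigma]_(y in qsphere) (u (dil (nrm x) y))%:E.

(* at [x = 0] the ball is empty and the expression is meaningless *)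
Definition D_const (sigma : set 'rV[R]_N -> \bar R) (p q : R)
    (u v : 'rV[R]_N -> R) : \bar R :=
  ereal_sup [set lebesgue_rV R N (qball (nrm x)) `^ (q^-1 - p^-1) *
                 spherical_mean sigma u x `^ q^-1 *
                 geometric_mean (fun y => (v y)^-1)%R x `^ p^-1
            | x in [set x | x != 0%R]].

Definition positive_fun (f : 'rV[R]_N -> R) : Prop :=
  measurable_fun setT f /\ forall x, (0 < f x)%R.

Definition geometric_mean_inequality (p q : R) (u v : 'rV[R]_N -> R) (C : R) :
    Prop :=
  forall f : 'rV[R]_N -> R, positive_fun f ->
    (\int[lebesgue_rV R N]_x (geometric_mean f x `^ q * (u x)%:E)) `^ q^-1 <=
    C%:E * (\int[lebesgue_rV R N]_x (f x `^ p * v x)%:E) `^ p^-1.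

Definition optimal_constant (p q : R) (u v : 'rV[R]_N -> R) (C : R) : Prop :=
  geometric_mean_inequality p q u v C /\
  forall C', geometric_mean_inequality p q u v C' -> (C <= C')%R.

End homogeneous_group_theory.

(* Main.v *)
From HB Require Import structures.
Require Import Defs.
From mathcomp Require Import all_boot all_order all_algebra.
From mathcomp Require Import all_classical all_reals all_analysis.
From mathcomp Require Import measurable_realfun.
From mathcomp Require Import ring lra.
Import Order.TTheory GRing.Theory Num.Theory.
Import numFieldNormedType.Exports.
Set Implicit Arguments.
Unset Strict Implicit.
Unset Printing Implicit Defensive.
Local Open Scope classical_set_scope.
Local Open Scope ring_scope.

(** Write [s = q / p >= 1], [g = f^p v], [A] for the integral of [g] and [|B_r|]
    for the volume of the ball [B(0,r)].  Geometric means being multiplicative,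
      GM(f)^q = GM(g)^s GM(1/v)^s.

    On [B_r] put [h(y) = |B_|y|| / |B_r| <= 1].  The mean of [ln h] over [B_r]
    is at least [-1] ([integral_ln_qball]), and Jensen's inequality applied to
    the first two terms of
      s ln g = ln (g h^s) + (s - 1) ln g - s ln h
    gives
      GM(g)^s <= e^s |B_r|^(-s) A^(s-1) J(r),
    where [J(r)] is the integral of [g h^s] over [B_r] ([exists_log_majorant],
    [geometric_mean_le]).

    In polar coordinates, the integral of [GM(f)^q u] only sees the spherical
    averages of [u].  The supremum [D] bounds the product of [GM(1/v)^s] and of
    the average of [u] over the sphere of radius [r] by [D^q |B_r|^(s-1)]
    ([D_const_radial_bound]), so the powers of [|B_r|] cancel up to [1 / |B_r|].
    It remains to integrate [J(r) / |B_r|] over the group in the variable [x],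
    [r = |x|]: by Tonelli it is the integral of [g(y)] times
      |B_|y||^s times the integral of |B_|x||^(-s-1) over |x| > |y|,
    which is [1 / s] for every [y] but the origin ([hardy_tail]).  Altogether
    the left-hand integral is at most [D^q e^s A^s / s]
    ([geometric_mean_integral_le]), and the root of order [q] of [e^s / s] is
    [(p/q)^(1/q) e^(1/p)].

    The polar decomposition also gives the volume of balls
    ([ge0_polar_coordinates], [measure_qball]).  The admissible constants are
    positive, as the constant function one shows, and when [D > 0] a suitable
    test function bounds them away from zero, so that their infimum is
    optimal. *)

(** * Integrals of powers over intervals *)

(** The line carries two copies of the Borel structure with Lebesgue measure;
    the identity map transports integrals from one copy to the other. *)
Lemma integral_lebesgue_R {R : realType} (D : set R) (f : R -> \bar R) :
  measurable D -> measurable_fun D f -> (forall x, D x -> (0 <= f x)%E) ->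
  (\int[@lebesgue_R R]_(x in D) f x = \int[@lebesgue_measure R]_(x in D) f x)%E.
Proof.
move=> mD mf f0.
have mid : measurable_fun setT (fun x : measurableTypeR R => x : R) by [].
have := @ge0_integral_pushforward _ _ _ _ _ _ mid (@lebesgue_measure R) D f
  mD mf.
by move=> <-; [exact: eq_measure_integral|move=> x /[!inE]; exact: f0].
Qed.

Section half_line_integrals.
Context {R : realType}.
Implicit Types (f F : R -> R) (a b r : R).
Local Notation mu := (@lebesgue_measure R).
Local Notation lam := (@lebesgue_R R).

Lemma integral_itv_derive F f a b : 0 < a -> a < b ->
  (forall x : R, 0 < x -> is_derive x 1 F (f x)) ->
  (forall x : R, 0 < x -> {for x, continuous f}) ->
  (\int[mu]_(x in `[a, b]) (f x)%:E = (F b - F a)%:E)%E.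
Proof.
move=> a0 ab dF cf; rewrite EFinB; apply: continuous_FTC2 => //.
- apply/continuous_in_subspaceT => x /[1!inE]/=.
  rewrite in_itv/= => /andP[ax _].
  by apply: cf; apply: lt_le_trans ax.
- have cF (x : R) : 0 < x -> {for x, continuous F}.
    move=> x0; apply/differentiable_continuous/derivable1_diffP.
    exact: (@ex_derive _ _ _ _ _ _ _ (dF x x0)).
  split.
  + move=> x; rewrite in_itv/= => /andP[ax _].
    exact: (@ex_derive _ _ _ _ _ _ _ (dF x (lt_trans a0 ax))).
  + apply: cvg_at_right_filter; exact: cF.
  + apply: cvg_at_left_filter; apply: cF; exact: lt_trans ab.
- move=> x; rewrite in_itv/= => /andP[ax _]; rewrite derive1E.
  by rewrite (@derive_val _ _ _ _ _ _ _ (dF x (lt_trans a0 ax))).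
Qed.

Lemma continuous_powR a (x : R) :
  0 < x -> {for x, continuous (fun y : R => y `^ a)}.
Proof.
move=> x0; apply/differentiable_continuous/derivable1_diffP.
by apply: derivable_powR; rewrite in_itv/= x0.
Qed.

Lemma integral_inv_itv a b : 0 < a -> a < b ->
  (\int[lam]_(x in `]a, b[) (x^-1)%:E = (ln b - ln a)%:E)%E.
Proof.
move=> a0 ab.
have mV : measurable_fun `]a, b[ (fun x : R => (x^-1)%:E).
  apply/measurable_EFinP; apply: open_continuous_measurable_fun => //.
  move=> x; rewrite inE/= in_itv/= => /andP[ax _].
  by apply: inv_continuous; rewrite gt_eqF// (lt_trans a0).
rewrite integral_lebesgue_R//; last first.
  move=> x /=; rewrite in_itv/= => /andP[ax _].
  by rewrite lee_fin invr_ge0 ltW// (lt_trans a0).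
rewrite -(@integral_itv_bndoo _ _ _ _ true false)//.
apply: integral_itv_derive => // x x0.
by apply: inv_continuous; rewrite gt_eqF.
Qed.

(** For [a < 1] the integrand blows up at the origin, so the value is the limit
    of the integrals over [[r / (n + 2), r]]. *)
Lemma integral_powR_itv0 a r : 0 < a -> 0 < r ->
  (\int[lam]_(x in `]0%R, r[) (x `^ (a - 1))%:E = (r `^ a / a)%:E)%E.
Proof.
move=> a0 r0.
have mf D : measurable_fun D (fun x : R => (x `^ (a - 1))%:E).
  apply/measurable_EFinP; apply: measurable_funTS; exact: measurable_powR.
rewrite integral_lebesgue_R//; last by move=> x _; rewrite lee_fin powR_ge0.
have r_gt n : 0 < r / n.+2%:R by rewrite divr_gt0.
pose E n : set R := `[r / n.+2%:R, r]%classic.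
have -> : `]0, r[%classic = \bigcup_n E n `\ r.
  apply/seteqP; split => [x /=|x [[n _]]] ; rewrite /E /= !in_itv/=.
    move=> /andP[x0 xr]; split; last by move=> xE; rewrite xE ltxx in xr.
    have [n nx] : exists n : nat, r / x < n%:R.
      exists (Num.bound (r / x)); apply: archi_boundP.
      by rewrite divr_ge0// ltW.
    exists n => //=; rewrite in_itv/= (ltW xr) andbT ler_pdivrMr// mulrC.
    rewrite -ler_pdivrMr//; apply/ltW/(lt_le_trans nx).
    by rewrite ler_nat -addn2 leq_addr.
  move=> /andP[nx xr] /eqP xne; rewrite (lt_le_trans (r_gt n))//=.
  by rewrite lt_neqAle xr xne.
have mE : measurable (\bigcup_n E n).
  by apply: bigcup_measurable => n _; exact: measurable_itv.
rewrite integral_setD1//; last exact: measurableD.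
have : (\int[mu]_(x in E n) (x `^ (a - 1))%:E @[n --> \oo] -->
    \int[mu]_(x in \bigcup_i E i) (x `^ (a - 1))%:E)%E.
  apply: ge0_nondecreasing_set_cvg_integral.
  - move=> m n mn; apply/subsetPset => x; rewrite /E/= !in_itv/=.
    move=> /andP[mx ->]; rewrite andbT; apply: le_trans mx.
    by rewrite ler_pM2l// lef_pV2 ?posrE// ler_nat.
  - by move=> n; exact: measurable_itv.
  - by move=> n; exact: mf.
  - by move=> n x _; rewrite lee_fin powR_ge0.
move=> cvgE; apply: (cvg_unique _ cvgE) => //.
have dF (x : R) : 0 < x -> is_derive x 1 (fun y => y `^ a / a) (x `^ (a - 1)).
  move=> x0; have dx := is_derive1_powR a x0.
  have := @is_deriveZ _ _ _ (fun y : R => y `^ a) a^-1 x 1 _ dx.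
  rewrite /GRing.scale/= mulrA mulVf ?gt_eqF// mul1r.
  by congr is_derive; apply/funext => y; rewrite mulrC.
apply: (@cvg_trans _ (((r `^ a - (r / n.+2%:R) `^ a) / a)%:E @[n --> \oo])).
  apply: near_eq_cvg; near=> n; apply/esym.
  rewrite (integral_itv_derive _ _ dF)//.
  - by rewrite mulrBl.
  - by rewrite ltr_pdivrMr// ltr_pMr// ltr1n.
  - by move=> x x0; exact: continuous_powR.
apply: cvg_EFin; first exact: nearW.
rewrite -[X in _ --> X / a]subr0.
apply: cvgMr_tmp; apply: cvgB; first exact: cvg_cst.
apply: (@cvg_comp _ _ _ (fun n => r / n.+2%:R) (fun y : R => y `^ a) _
  (0^'+)); last exact: powR_cvg0.
have r0cvg : r / n.+2%:R @[n --> \oo] --> 0.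
  rewrite -[X in _ --> X](mulr0 r); apply: cvgMl_tmp.
  by have := @cvg_harmonic R; rewrite -cvg_shiftS.
move=> U /r0cvg; apply: (@filterS nat \oo) => n /= UP; exact: UP (r_gt n).
Unshelve. all: by end_near. Qed.

Lemma cvg_powRN_pinfty a : 0 < a -> x `^ (- a) @[x --> +oo] --> (0 : R).
Proof.
move=> a0; apply/cvgr0Pnorm_le => e e0; near=> x.
have x0 : 0 < x by near: x; exact: nbhs_pinfty_gt.
rewrite ger0_norm ?powR_ge0// powRN -[leRHS]invrK.
rewrite lef_pV2 ?posrE ?powR_gt0 ?invr_gt0//.
have -> : e^-1 = (e^-1 `^ a^-1) `^ a.
  by rewrite -powRrM mulVf ?gt_eqF// powRr1// invr_ge0 ltW.
by rewrite ge0_ler_powR ?nnegrE ?powR_ge0 ?(ltW a0) ?(ltW x0).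
Unshelve. all: by end_near. Qed.

Lemma integral_powR_itvy a r : 0 < a -> 0 < r ->
  (\int[lam]_(x in `]r, +oo[) (x `^ (- a - 1))%:E = (r `^ (- a) / a)%:E)%E.
Proof.
move=> a0 r0.
have dF (x : R) : 0 < x ->
    is_derive x 1 (fun y => - (y `^ (- a) / a)) (x `^ (- a - 1)).
  move=> x0; have dx := is_derive1_powR (- a) x0.
  have := @is_deriveZ _ _ _ (fun y : R => y `^ (- a)) (- a^-1) x 1 _ dx.
  rewrite /GRing.scale/= mulrA mulrNN mulVf ?gt_eqF// mul1r.
  by congr is_derive; apply/funext => y; rewrite [in RHS]mulrC -mulNr.
have mf : measurable_fun `]r, +oo[ (fun x : R => (x `^ (- a - 1))%:E).
  by apply/measurable_EFinP; apply: measurable_funTS; exact: measurable_powR.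
rewrite integral_lebesgue_R//; last by move=> x _; rewrite lee_fin powR_ge0.
rewrite (@integral_itv_obnd_cbnd _ r +oo%O)//.
rewrite (@ge0_continuous_FTC2y _ _ (fun y => - (y `^ (- a) / a)) r 0).
- by rewrite -EFinB sub0r opprK.
- by move=> x _; exact: powR_ge0.
- apply/continuous_within_itvcyP; split.
    move=> x; rewrite in_itv/= andbT => rx.
    by apply: continuous_powR; exact: lt_trans rx.
  by apply: cvg_at_right_filter; exact: continuous_powR.
- have := cvgN (cvgMr_tmp (b := a^-1) (cvg_powRN_pinfty a0)).
  by rewrite mul0r oppr0; apply; exact: pinfty_nbhs_filter.
- by move=> x rx; exact: (@ex_derive _ _ _ _ _ _ _ (dF x (lt_trans r0 rx))).
- have /derivable1_diffP/differentiable_continuous cF :=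
    @ex_derive _ _ _ _ _ _ _ (dF r r0).
  exact: cvg_at_right_filter cF.
- move=> x; rewrite in_itv/= andbT => rx; rewrite derive1E.
  by rewrite (@derive_val _ _ _ _ _ _ _ (dF x (lt_trans r0 rx))).
Qed.

End half_line_integrals.

(** * Measurability on row vectors, and nonnegative integrals *)

Section row_vectors.
Context {R : realType} {n : nat}.

(** An open set is the union of the countably many cubes with rational centre
    and radius [1 / (k + 1)] that it contains. *)
Lemma measurable_open_rV (U : set 'rV[R]_n) : open U -> measurable U.
Proof.
move=> oU.
pose a (k : 'rV[rat]_n * nat) : 'rV[R]_n := map_mx ratr k.1.
pose B (k : 'rV[rat]_n * nat) : set 'rV[R]_n :=
  [set x | forall i, `|a k ord0 i - x ord0 i| < k.2.+1%:R^-1].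
have mB k : measurable (B k).
  rewrite (_ : B k = \bigcap_(i in [set: 'I_n])
      ((fun x : 'rV[R]_n => x ord0 i) @^-1`
        [set t | `|a k ord0 i - t| < k.2.+1%:R^-1])); last first.
    by apply/seteqP; split => [x Bx i _|x Bx i]; [exact: Bx|exact: Bx].
  apply: fin_bigcap_measurable => // i _.
  rewrite -[X in measurable X]setTI.
  apply: measurable_rV_coord => //.
  rewrite (_ : mkset _ = ball (a k ord0 i : R) k.2.+1%:R^-1)//.
  exact: measurable_ball.
pose V k : set 'rV[R]_n := if `[< B k `<=` U >] then B k else set0.
suff -> : U = \bigcup_k V k.
  apply: countable_bigcupT_measurable; first exact: countableP.
  by move=> k; rewrite /V; case: ifP.
apply/seteqP; split => [x Ux|x [k _]]; last first.
  by rewrite /V; case: ifP => // /asboolP; exact.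
have /nbhs_ballP[e /= e0 xeU] : nbhs x U by exact: open_nbhs_nbhs.
have [m me] : exists m, m.+1%:R^-1 < e / 2.
  have e20 : 0 < e / 2 by rewrite divr_gt0.
  exists (Num.bound (e / 2)^-1).
  rewrite -[ltRHS]invrK ltf_pV2 ?posrE ?invr_gt0//.
  apply: (lt_trans (archi_boundP _)); first by rewrite invr_ge0 ltW.
  by rewrite ltr_nat.
have m0 : (0 : R) < m.+1%:R^-1 by rewrite invr_gt0.
have rx i : exists c : rat, `|ratr c - x ord0 i| < m.+1%:R^-1.
  have [|c] := @rat_in_itvoo R (x ord0 i - m.+1%:R^-1) (x ord0 i + m.+1%:R^-1).
    by rewrite ltrBlDr -addrA ltrDl addr_gt0.
  by rewrite in_itv/= => cx; exists c; rewrite ltr_distl.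
have [c cx] := choice rx.
pose k := (\row_i c i, m); exists k => //.
rewrite /V ifT.
  by move=> i; rewrite /a /= !mxE; exact: cx.
apply/asboolP => y By; apply: xeU; split => // i j; rewrite (ord1 i) /ball/=.
move: me (cx j) (By j); rewrite /a /= !mxE; move: (m.+1%:R^-1) => t te.
rewrite !ltr_norml => /andP[? ?] /andP[? ?]; apply/andP; split; lra.
Qed.

Lemma measurable_continuous_rV (f : 'rV[R]_n -> R) :
  continuous f -> measurable_fun setT f.
Proof.
move=> cf.
apply: (measurability _ (RGenOInfty.measurableE R)).
move=> _ [_ [x ->] <-]; rewrite setTI; apply: measurable_open_rV.
by apply: open_comp => // y _; exact: cf.
Qed.

End row_vectors.

Section nonneg_integrals.
Local Open Scope ereal_scope.
Context {R : realType} {d1 d2 : measure_display}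
  {T1 : measurableType d1} {T2 : measurableType d2}.

Lemma cvg_ge0_integral (m : {measure set T1 -> \bar R}) (D : set T1)
    (g : (T1 -> \bar R)^nat) (f : T1 -> \bar R) : measurable D ->
  (forall n, measurable_fun D (g n)) -> (forall n x, D x -> 0 <= g n x) ->
  (forall x, D x -> nondecreasing_seq (g ^~ x)) ->
  (forall x, D x -> g n x @[n --> \oo] --> f x) ->
  \int[m]_(x in D) g n x @[n --> \oo] --> \int[m]_(x in D) f x.
Proof.
move=> mD mg g0 ndg gf.
rewrite (_ : \int[m]_(x in D) f x = \int[m]_(x in D) limn (g ^~ x)).
  exact: cvg_monotone_convergence.
by apply: eq_integral => x /[!inE] Dx; apply/esym/cvg_lim => //; exact: gf.
Qed.

Lemma measurable_fun_integral_ge0 (m : {sigma_finite_measure set T2 -> \bar R})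
    (D : set T2) (f : T1 * T2 -> \bar R) : measurable D ->
  measurable_fun setT f -> (forall x y, D y -> 0 <= f (x, y)) ->
  measurable_fun setT (fun x => \int[m]_(y in D) f (x, y)).
Proof.
move=> mD mf f0.
have mTD : measurable ([set: T1] `*` D) by exact: measurableX.
under eq_fun do rewrite integral_mkcond.
rewrite (_ : (fun x => _) = fubini_F m (f \_ ([set: T1] `*` D))).
  apply: measurable_fun_fubini_tonelli_F.
    by apply/(measurable_restrictT f) => //; exact: measurable_funTS.
  by move=> [x y]; apply: erestrict_ge0 => -[? ?] [_ ?]; exact: f0.
apply/funext => x; rewrite /fubini_F; apply: eq_integral => y _.
by rewrite !patchE in_setX in_setT.
Qed.

Lemma ge0_tonelli (m1 : {sigma_finite_measure set T1 -> \bar R})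
    (m2 : {sigma_finite_measure set T2 -> \bar R})
    (D1 : set T1) (D2 : set T2) (f : T1 -> T2 -> \bar R) :
  measurable D1 -> measurable D2 ->
  measurable_fun setT (fun z : T1 * T2 => f z.1 z.2) ->
  (forall x y, D1 x -> D2 y -> 0 <= f x y) ->
  \int[m1]_(x in D1) \int[m2]_(y in D2) f x y =
  \int[m2]_(y in D2) \int[m1]_(x in D1) f x y.
Proof.
move=> mD1 mD2 mf f0.
have mD : measurable (D1 `*` D2) by exact: measurableX.
pose g := (fun z : T1 * T2 => f z.1 z.2) \_ (D1 `*` D2).
have gE x y : g (x, y) = if (x \in D1) && (y \in D2) then f x y else 0.
  by rewrite /g patchE in_setX.
transitivity (\int[m1]_x \int[m2]_y g (x, y)).
  rewrite integral_mkcond; apply: eq_integral => x _.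
  rewrite patchE; case: ifPn => xD.
    rewrite integral_mkcond; apply: eq_integral => y _.
    by rewrite gE patchE xD.
  by rewrite integral0_eq// => y _; rewrite gE (negbTE xD).
rewrite fubini_tonelli//; last 2 first.
  - apply/(measurable_restrictT (fun z : T1 * T2 => f z.1 z.2)) => //.
    exact: measurable_funTS.
  - by move=> z; apply: erestrict_ge0 => -[? ?] [? ?]; exact: f0.
rewrite [RHS]integral_mkcond; apply: eq_integral => y _.
rewrite patchE; case: ifPn => yD.
  rewrite [RHS]integral_mkcond; apply: eq_integral => x _.
  by rewrite gE patchE yD andbT.
by rewrite integral0_eq// => x _; rewrite gE (negbTE yD) andbF.
Qed.

Lemma integral_gt0 (m : {measure set T1 -> \bar R}) (D : set T1)
    (f : T1 -> \bar R) : measurable D -> measurable_fun D f ->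
  (forall x, D x -> 0 < f x) -> 0 < m D -> 0 < \int[m]_(x in D) f x.
Proof.
move=> mD mf f0 mD0; rewrite lt_neqAle integral_ge0 ?andbT; last first.
  by move=> x /f0/ltW.
apply/eqP => /esym int0.
have : \int[m]_(x in D) `|f x| = 0.
  by rewrite -[RHS]int0; apply: eq_integral => x /[!inE]/f0/ltW/gee0_abs.
move/(ae_eq_integral_abs _ mD mf) => [N [mN N0 DN]].
suff : m D <= m N by rewrite N0 leNgt mD0.
apply: le_measure; rewrite ?inE// => x Dx; apply: DN => /= /(_ Dx) fx0.
by have := f0 _ Dx; rewrite fx0 ltxx.
Qed.

End nonneg_integrals.

(** * Integrals with values in the extended line *)

Lemma measurable_expeR {R : realType} : measurable_fun setT (@expeR R).
Proof.
have mpt (e : \bar R) : measurable_fun setT (fun x : \bar R => x == e).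
  apply: (measurable_fun_bool true); rewrite setTI.
  rewrite (_ : _ @^-1` _ = [set e]); first exact: emeasurable_set1.
  by apply/seteqP; split => x /= /eqP.
rewrite (_ : @expeR R = fun x => if x == +oo%E then +oo%E else
    if x == -oo%E then 0%E else (expR (fine x))%:E); last first.
  by apply/funext => -[].
apply: measurable_fun_ifT => //; apply: measurable_fun_ifT => //.
apply/measurable_EFinP; apply: (measurableT_comp (@measurable_expR R)).
exact: fine_measurable.
Qed.

Section extended_integrals.
Local Open Scope ereal_scope.
Context {d : measure_display} {T : measurableType d} {R : realType}.
Context (m : {measure set T -> \bar R}) (D : set T) (mD : measurable D).

Lemma integral_eqNy (f : T -> \bar R) :
  \int[m]_(x in D) f^\- x = +oo -> \int[m]_(x in D) f x = -oo.
Proof. by move=> fN; rewrite integralE fN addeC. Qed.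

Lemma integrable_of_funeneg (f : T -> \bar R) : measurable_fun D f ->
  \int[m]_(x in D) f x < +oo -> \int[m]_(x in D) f^\- x < +oo ->
  m.-integrable D f.
Proof.
move=> mf foo fNoo; apply/integrableP; split=> //.
have fN : \int[m]_(x in D) f^\- x \is a fin_num.
  by rewrite ge0_fin_numE// integral_ge0.
have fP : \int[m]_(x in D) f^\+ x < +oo.
  move: foo; rewrite integralE lteBlDr// => /lt_le_trans; apply.
  by rewrite leey.
under eq_integral do rewrite -/((abse \o f) _) fune_abse.
rewrite ge0_integralD//.
- by rewrite lte_add_pinfty.
- exact: measurable_funepos.
- exact: measurable_funeneg.
Qed.

(** Monotonicity of integrals that may be infinite: if the negative part of
    [psi] is not integrable then, [k] being integrable, neither is that of
    [phi], and both sides are [-oo]. *)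
Lemma integral_le_affine (phi psi k : T -> R) (a : R) : (0 < a)%R ->
  measurable_fun D phi -> measurable_fun D psi ->
  m.-integrable D (EFin \o k) ->
  \int[m]_(x in D) (psi x)%:E < +oo ->
  {ae m, forall x, D x -> (phi x <= a * psi x + k x)%R} ->
  \int[m]_(x in D) (phi x)%:E <=
    a%:E * \int[m]_(x in D) (psi x)%:E + \int[m]_(x in D) (k x)%:E.
Proof.
move=> a0 mphi mpsi ik psioo le_phi.
have mEpsi : measurable_fun D (EFin \o psi) by exact/measurable_EFinP.
have mEphi : measurable_fun D (EFin \o phi) by exact/measurable_EFinP.
have mEk : measurable_fun D (EFin \o k) by exact: measurable_int ik.
have fun_neg0 (f : T -> \bar R) : 0 <= \int[m]_(x in D) f^\- x.
  exact: integral_ge0.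
have [psiNoo|psiNoo] := ltP (\int[m]_(x in D) (EFin \o psi)^\- x) +oo.
  have ipsi := integrable_of_funeneg mEpsi psioo psiNoo.
  have iapsi : m.-integrable D (fun x => a%:E * (psi x)%:E).
    exact: integrableZl.
  rewrite -(integralZl mD ipsi) -(integralD mD iapsi ik).
  rewrite integralE [leRHS]integralE; apply: leeB.
    apply: ae_ge0_le_integral => //.
    - exact: measurable_funepos.
    - apply: measurable_funepos; apply: emeasurable_funD => //.
      exact: measurable_int iapsi.
    - apply: filterS le_phi => x + Dx => /(_ Dx) xle.
      rewrite !funeposE ge_max !le_max lexx orbT andbT.
      by apply/orP; left; exact: xle.
  apply: ae_ge0_le_integral => //.
  - apply: measurable_funeneg; apply: emeasurable_funD => //.
    exact: measurable_int iapsi.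
  - exact: measurable_funeneg.
  - apply: filterS le_phi => x + Dx => /(_ Dx) xle.
    rewrite !funenegE ge_max !le_max lexx orbT andbT.
    by apply/orP; left; rewrite leeN2; exact: xle.
rewrite [leLHS]integral_eqNy ?leNye//; apply/eqP; rewrite -leye_eq leNgt.
apply/negP => phiNoo; move: psiNoo; rewrite leNgt => /negP; apply.
have /integrableP[_ koo] := ik.
apply: (@le_lt_trans _ _ (\int[m]_(x in D)
    ((a^-1)%:E * ((EFin \o phi)^\- x + `|(k x)%:E|)))).
  apply: ae_ge0_le_integral => //.
  - exact: measurable_funeneg.
  - move=> x _; apply: mule_ge0; first by rewrite lee_fin invr_ge0 ltW.
    by rewrite adde_ge0 ?funeneg_ge0.
  - apply: measurable_funeM; apply: emeasurable_funD.
      exact: measurable_funeneg.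
    exact: measurableT_comp.
  - apply: filterS le_phi => x + Dx => /(_ Dx) xle.
    rewrite !funenegE /= -!EFin_max -EFinD -EFinM lee_fin.
    rewrite mulrC ler_pdivlMr// mulrC maxr_pMr ?(ltW a0)// mulr0.
    have := ler_norm (k x).
    have : (- phi x <= Num.max (- phi x) 0)%R by rewrite le_max lexx.
    have : (0 <= Num.max (- phi x) 0)%R by rewrite le_max lexx orbT.
    have := normr_ge0 (k x).
    rewrite ge_max => ? ? ? ?; apply/andP; split; lra.
rewrite ge0_integralZl//.
- rewrite ge0_integralD//.
  + by rewrite lte_mul_pinfty ?lee_fin ?invr_ge0 ?ltW// lte_add_pinfty.
  + exact: measurable_funeneg.
  + exact: measurableT_comp.
- apply: emeasurable_funD; [exact: measurable_funeneg|exact: measurableT_comp].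
- by move=> x _; rewrite adde_ge0.
- by rewrite lee_fin invr_ge0 ltW.
Qed.

End extended_integrals.

(** * Polar coordinates *)

Section polar_coordinates.
Import HBNNSimple.
Local Open Scope ereal_scope.
Context {R : realType} {N : nat} (G : homogeneous_group R N)
  (nrm : quasi_norm G).
Local Notation V := 'rV[R]_N.
Local Notation m := (lebesgue_rV R N).
Local Notation Q := (homogeneous_dim G).
Local Notation S := (qsphere nrm).

Lemma measurable_dil d (T : measurableType d) (r : T -> R) (y : T -> V) :
  measurable_fun setT r -> measurable_fun setT y ->
  measurable_fun setT (fun t => dil G (r t) (y t)).
Proof.
move=> mr my; apply: measurable_fun_rVP => i.
under eq_fun do rewrite /dil /dilate mxE.
apply: measurable_funM.
  exact: (measurableT_comp (measurable_powR _)).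
exact: (measurableT_comp (measurable_rV_coord i)).
Qed.

Lemma measurable_quasi_norm : measurable_fun setT nrm.
Proof. apply: measurable_continuous_rV; exact: qn_continuous. Qed.

Lemma measurable_qsphere : measurable S.
Proof.
rewrite [X in measurable X](_ : _ = nrm @^-1` [set 1%R])//.
by rewrite -[X in measurable X]setTI; apply: measurable_quasi_norm.
Qed.

Lemma measurable_qball r : measurable (qball nrm r).
Proof.
rewrite [X in measurable X](_ : _ = nrm @^-1` `]-oo, r[%classic).
  by rewrite -[X in measurable X]setTI; apply: measurable_quasi_norm.
by apply/seteqP; split => y; rewrite /qball /= in_itv.
Qed.

Lemma mem_qball r y : (y \in qball nrm r) = (nrm y < r)%R.
Proof. by apply/idP/idP; rewrite inE. Qed.

Lemma measurable_origin : measurable [set 0%R : V].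
Proof.
rewrite (_ : [set _] = nrm @^-1` [set 0%R]).
  by rewrite -[X in measurable X]setTI; apply: measurable_quasi_norm.
by apply/seteqP; split => x /=; rewrite qn_eq0.
Qed.

Lemma quasi_norm_gt0 y : y != 0%R -> (0 < nrm y)%R.
Proof.
move=> y0; rewrite lt_neqAle qn_ge0 andbT eq_sym.
by apply/eqP => /qn_eq0/eqP; rewrite (negbTE y0).
Qed.

Lemma qn_dil_qsphere r y : (0 < r)%R -> S y -> nrm (dil G r y) = r.
Proof. by move=> r0 Sy; rewrite qn_dil// Sy mulr1. Qed.

Context (sigma : {measure set V -> \bar R}) (hs : polar_measure nrm sigma).

(** A copy of [sigma] that remembers the polar decomposition, hence is known to
    be finite: Tonelli's theorem applies to it. *)
Definition sphere_measure (_ : polar_measure nrm sigma) : set V -> \bar R :=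
  sigma.

HB.instance Definition _ hs' := Measure.copy (sphere_measure hs') sigma.

Lemma sphere_measure_finite hs' : fin_num_fun (sphere_measure hs').
Proof.
apply: lty_fin_num_fun => //; rewrite /sphere_measure -(setUv S).
have [sC sS _] := hs'.
apply: (@le_lt_trans _ _ (sigma S + sigma (~` S))); last by rewrite sC adde0.
apply: measureU2; first exact: measurable_qsphere.
by apply: measurableC; exact: measurable_qsphere.
Qed.

HB.instance Definition _ hs' := @Measure_isFinite.Build _ _ _
  (sphere_measure hs') (sphere_measure_finite hs').

Lemma measurable_polar_integrand (f : V -> \bar R) :
  measurable_fun setT f ->
  measurable_fun setT (fun z : R * V =>
    f (dil G z.1 z.2) * (z.1 `^ (Q - 1))%:E).
Proof.
move=> mf; apply: emeasurable_funM.
  by apply: (measurableT_comp mf); exact: measurable_dil.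
apply/measurable_EFinP.
exact: (measurableT_comp (measurable_powR _)).
Qed.

Lemma measurable_polar_inner (f : V -> \bar R) :
  measurable_fun setT f -> (forall x, 0 <= f x) ->
  measurable_fun setT
    (fun r => \int[sigma]_(y in S) (f (dil G r y) * (r `^ (Q - 1))%:E)).
Proof.
move=> mf f0.
apply: (@measurable_fun_integral_ge0 _ _ _ _ _ (sphere_measure hs) S
  (fun z : R * V => f (dil G z.1 z.2) * (z.1 `^ (Q - 1))%:E)).
- exact: measurable_qsphere.
- exact: measurable_polar_integrand.
- by move=> x y _; rewrite mule_ge0// lee_fin powR_ge0.
Qed.

(** The polar decomposition is postulated for integrable functions only.  A
    nonnegative measurable function is the increasing limit of bounded functions
    supported in sets of finite measure, and monotone convergence passes to the
    limit on both sides.  The finiteness of the volume of a ball will be a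
    consequence. *)
Theorem ge0_polar_coordinates (f : V -> \bar R) :
  measurable_fun setT f -> (forall x, 0 <= f x) ->
  \int[m]_x f x = \int[@lebesgue_R R]_(r in `]0%R, +oo[)
    \int[sigma]_(y in S) (f (dil G r y) * (r `^ (Q - 1))%:E).
Proof.
move=> mf f0.
have [K [KT ndK mK]] : exists K, [/\ [set: V] = \bigcup_i K i,
    nondecreasing_seq K & forall i, measurable (K i) /\ m (K i) < +oo].
  exact: (sigma_finiteP _ _).1 (sigma_finiteT m).
pose g (n : nat) (x : V) : R :=
  (nnsfun_approx measurableT mf n x * \1_(K n) x)%R.
have g0 n x : (0 <= g n x)%R by rewrite mulr_ge0.
have mg n : measurable_fun setT (g n).
  apply: measurable_funM => //.
  by apply: measurable_indic; exact: (mK n).1.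
have ndg x : nondecreasing_seq (fun n => (g n x)%:E).
  move=> a b ab; rewrite lee_fin ler_pM//.
    exact/lefP/nd_nnsfun_approx.
  rewrite !indicE ler_nat; case: (boolP (x \in K a)) => // /[!inE] Kax.
  by rewrite mem_set//; move: x Kax; apply/subsetPset/ndK.
have gf x : (g n x)%:E @[n --> \oo] --> f x.
  have := @cvg_nnsfun_approx _ _ _ _ measurableT f mf (fun x _ => f0 x) x
    Logic.I.
  apply: cvg_trans; apply: near_eq_cvg.
  have [k _ Kkx] : (\bigcup_i K i) x by rewrite -KT.
  near=> n; rewrite /= /g indicE mem_set ?mulr1//.
  have kn : (k <= n)%N by near: n; exact: nbhs_infty_ge.
  by move: x Kkx; apply/subsetPset/ndK.
have ig n : m.-integrable setT (EFin \o g n).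
  have -> : EFin \o g n = (EFin \o nnsfun_approx measurableT mf n) \_ (K n).
    apply/funext => x; rewrite patchE /= /g indicE.
    by case: ifPn; rewrite ?mulr1 ?mulr0.
  apply/(integrable_mkcond _ (mK n).1); apply: measurable_bounded_integrable.
  - exact: (mK n).1.
  - exact: (mK n).2.
  - exact: measurable_funTS.
  - have [M [Mr bM]] := simple_bounded (nnsfun_approx measurableT mf n).
    by exists M; split=> // x Mx y _; exact: bM.
have lhs : \int[m]_x (g n x)%:E @[n --> \oo] --> \int[m]_x f x.
  apply: cvg_ge0_integral => //.
    by move=> n; exact/measurable_EFinP.
  by move=> n x _; rewrite lee_fin.
apply: (cvg_unique _ lhs) => //.
have [_ _ polar] := hs.
have dilE n (r : R) y : (g n (dil G r y) * r `^ (Q - 1))%:E =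
    (g n (dil G r y))%:E * (r `^ (Q - 1))%:E by rewrite EFinM.
have polarE n : \int[m]_x (g n x)%:E = \int[@lebesgue_R R]_(r in `]0%R, +oo[)
    \int[sigma]_(y in S) (g n (dil G r y) * r `^ (Q - 1))%:E.
  rewrite polar// integral_lebesgue_R//.
    apply: measurable_funTS.
    under eq_fun do under eq_integral do rewrite dilE.
    apply: (@measurable_polar_inner (EFin \o g n)).
      exact/measurable_EFinP.
    by move=> x; rewrite lee_fin.
  by move=> r _; apply: integral_ge0 => y _; rewrite lee_fin mulr_ge0 ?powR_ge0.
rewrite (funext polarE).
have mgd n (r : R) :
    measurable_fun S (fun y => (g n (dil G r y) * r `^ (Q - 1))%:E).
  apply: measurable_funTS; apply/measurable_EFinP; apply: measurable_funM => //.
  by apply: (measurableT_comp (mg n)); exact: measurable_dil.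
have ndgd (r : R) y :
    nondecreasing_seq (fun n => (g n (dil G r y) * r `^ (Q - 1))%:E).
  by move=> a b ab; rewrite !dilE lee_wpmul2r ?lee_fin ?powR_ge0//; exact: ndg.
have gd0 n (r : R) y : 0 <= (g n (dil G r y) * r `^ (Q - 1))%:E.
  by rewrite lee_fin mulr_ge0 ?powR_ge0.
have mS := measurable_qsphere.
apply: (@cvg_ge0_integral R _ R (@lebesgue_R R) _ (fun n r =>
  \int[sigma]_(y in S) (g n (dil G r y) * r `^ (Q - 1))%:E)) => //.
- move=> n; apply: measurable_funTS.
  under eq_fun do under eq_integral do rewrite dilE.
  apply: (@measurable_polar_inner (EFin \o g n)).
    exact/measurable_EFinP.
  by move=> x; rewrite lee_fin.
- by move=> n r _; apply: integral_ge0.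
- move=> r _ a b ab /=; apply: ge0_le_integral => [|y _|||y _].
  + exact: mS.
  + exact: gd0.
  + exact: mgd.
  + exact: mgd.
  + exact: ndgd.
- move=> r; rewrite /= in_itv/= andbT => r0.
  apply: cvg_ge0_integral => [|n|n y _|y _|y _].
  + exact: mS.
  + exact: mgd.
  + exact: gd0.
  + exact: ndgd.
  + under eq_fun do rewrite dilE.
    by apply: cvgeMr; [rewrite fin_numE|exact: gf].
Unshelve. all: by end_near. Qed.

End polar_coordinates.

(** * Volumes of quasi-balls *)

Section volumes.
Local Open Scope ereal_scope.
Context {R : realType} {N : nat} (G : homogeneous_group R N)
  (nrm : quasi_norm G).
Local Notation V := 'rV[R]_N.
Local Notation m := (lebesgue_rV R N).
Local Notation Q := (homogeneous_dim G).
Local Notation S := (qsphere nrm).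
Context (sigma : {measure set V -> \bar R}) (hs : polar_measure nrm sigma)
  (hN : (0 < N)%N).

Lemma homogeneous_dim_gt0 : (0 < Q)%R.
Proof.
rewrite /homogeneous_dim (bigD1 (Ordinal hN))//=.
by rewrite ltr_pwDl ?hg_weight_gt0// sumr_ge0// => i _; exact/ltW/hg_weight_gt0.
Qed.

(** Integrating a radial function against [k] only sees the spherical integrals
    of [k]. *)
Lemma polar_radial (h : R -> \bar R) (k : V -> \bar R) :
  measurable_fun setT h -> (forall r, 0 <= h r) ->
  measurable_fun setT k -> (forall x, 0 <= k x) ->
  \int[m]_x (h (nrm x) * k x) =
  \int[@lebesgue_R R]_(r in `]0%R, +oo[)
    (h r * (r `^ (Q - 1))%:E * \int[sigma]_(y in S) k (dil G r y)).
Proof.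
move=> mh h0 mk k0.
rewrite (ge0_polar_coordinates hs)//; last 2 first.
- apply: emeasurable_funM => //; apply: (measurableT_comp mh).
  exact: measurable_quasi_norm.
- by move=> x; rewrite mule_ge0.
apply: eq_integral => r; rewrite inE/= in_itv/= andbT => r0.
rewrite -ge0_integralZl.
- apply: eq_integral => y /[!inE] Sy.
  by rewrite (qn_dil_qsphere r0 Sy) muleAC.
- exact: measurable_qsphere.
- apply: measurable_funTS; apply: (measurableT_comp mk).
  exact: measurable_dil.
- by [].
- by rewrite mule_ge0// lee_fin powR_ge0.
Qed.

Lemma sphere_measure_fin : sigma S \is a fin_num.
Proof. by have [_ ? _] := hs; rewrite ge0_fin_numE. Qed.

Lemma polar_radial1 (h : R -> \bar R) :
  measurable_fun setT h -> (forall r, 0 <= h r) ->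
  \int[m]_x h (nrm x) =
  sigma S * \int[@lebesgue_R R]_(r in `]0%R, +oo[) (h r * (r `^ (Q - 1))%:E).
Proof.
move=> mh h0.
under eq_integral do rewrite -[h _]mule1.
rewrite (polar_radial mh h0 (measurable_cst 1))//.
have cstE r : \int[sigma]_(y in S) cst 1 (dil G r y) = sigma S.
  rewrite -[RHS]mul1e -(integral_cst sigma (measurable_qsphere nrm) 1).
  exact: eq_integral.
under eq_integral do rewrite cstE muleC.
rewrite ge0_integralZl//.
- apply: measurable_funTS; apply: emeasurable_funM => //.
  by apply/measurable_EFinP; exact: measurable_powR.
- by move=> r _; rewrite mule_ge0// lee_fin powR_ge0.
Qed.

Lemma lebesgue_rV_origin : m [set 0%R : V] = 0.
Proof.
have := @lebesgue_rV_box R N 0 0 (fun=> lexx _).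
rewrite (_ : mkset _ = [set 0%R : V]).
  by rewrite (bigD1 (Ordinal hN))//= subrr mul0r.
apply/seteqP; split => [x /= x0|x ->] /=; last by move=> i; rewrite mxE lexx.
by apply/rowP => i; apply/eqP; rewrite eq_le andbC; have := x0 i; rewrite !mxE.
Qed.

Lemma lebesgue_rV_gt0 : 0 < m setT.
Proof.
have mbox : measurable [set x : V | forall i, 0 <= x ord0 i <= 1]%R.
  rewrite (_ : mkset _ = \bigcap_(i in [set: 'I_N])
      ((fun x : V => x ord0 i) @^-1` `[0%R, 1%R])).
    apply: fin_bigcap_measurable => // i _; rewrite -[X in measurable X]setTI.
    by apply: measurable_rV_coord.
  apply/seteqP; split => [x x01 i _ /=|x x01 i].
    by rewrite in_itv/=; exact: x01.
  by have := x01 i Logic.I; rewrite /= in_itv/=.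
apply: (@lt_le_trans _ _ (m [set x : V | forall i, 0 <= x ord0 i <= 1]%R));
    last first.
  by apply: le_measure; rewrite ?inE.
have := @lebesgue_rV_box R N 0 (const_mx 1%R) _.
rewrite (_ : mkset _ = [set x : V | forall i, 0 <= x ord0 i <= 1]%R).
  move=> ->; last by move=> i; rewrite !mxE.
  by rewrite big1 ?lte01// => i _; rewrite !mxE subr0.
by apply/seteqP; split => x /= x01 i; have := x01 i; rewrite !mxE.
Qed.

(** Otherwise every integral vanishes by [polar_radial1], and so does the volume
    of the whole space. *)
Lemma sphere_measure_gt0 : 0 < sigma S.
Proof.
rewrite lt_neqAle measure_ge0 andbT; apply/eqP => S0.
have := lebesgue_rV_gt0.
rewrite -[m setT]mul1e -(integral_cst m measurableT 1).
by rewrite (polar_radial1 (measurable_cst 1)) ?lee01// -S0 mul0e ltxx.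
Qed.

Definition ball_volume (r : R) : R := (fine (sigma S) / Q * r `^ Q)%R.

Lemma fine_sphere_gt0 : (0 < fine (sigma S))%R.
Proof.
by rewrite fine_gt0// sphere_measure_gt0 -ge0_fin_numE ?sphere_measure_fin.
Qed.

Lemma ball_volume_gt0 r : (0 < r)%R -> (0 < ball_volume r)%R.
Proof.
move=> r0; rewrite mulr_gt0 ?powR_gt0// divr_gt0 ?fine_sphere_gt0//.
exact: homogeneous_dim_gt0.
Qed.

Lemma measure_qball r : (0 < r)%R -> m (qball nrm r) = (ball_volume r)%:E.
Proof.
move=> r0; have mr : measurable (`]-oo, r[ : set R) by exact: measurable_itv.
rewrite -[LHS]mul1e -integral_cst; last exact: measurable_qball.
rewrite integral_mkcond.
transitivity (\int[m]_x (\1_(`]-oo, r[ : set R) (nrm x))%:E).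
  apply: eq_integral => x _; rewrite patchE indicE /=.
  by rewrite mem_qball mem_setE in_itv/=; case: ifP.
rewrite (polar_radial1 (h := fun t => (\1_(`]-oo, r[ : set R) t)%:E)).
- transitivity (sigma S * (r `^ Q / Q)%:E); last first.
    rewrite -[sigma S]fineK ?sphere_measure_fin// -EFinM /ball_volume.
    by rewrite mulrAC mulrA.
  congr (_ * _); rewrite -integral_powR_itv0 ?homogeneous_dim_gt0//.
  rewrite integral_mkcond [RHS]integral_mkcond.
  apply: eq_integral => t _; rewrite !patchE indicE.
  rewrite !mem_setE !in_itv/= andbT.
  by case: (0 < t)%R => //=; case: (t < r)%R; rewrite ?mul1e ?mul0e.
- by apply/measurable_EFinP; exact: measurable_indic.
- by move=> t; rewrite lee_fin.
Qed.

Lemma measurable_ln_ratio r :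
  measurable_fun setT (fun y => (ln (r / nrm y))%:E).
Proof.
apply/measurable_EFinP.
rewrite (_ : (fun y => _) = (fun y => ln (r * nrm y `^ (- 1)))%R).
  apply: (measurableT_comp (@measurable_ln R)); apply: measurable_funM => //.
  apply: (measurableT_comp (measurable_powR _)); exact: measurable_quasi_norm.
by apply/funext => y; rewrite powR_inv1// qn_ge0.
Qed.

Lemma ln_ratio_ge0 r y : qball nrm r y -> (0 <= ln (r / nrm y))%R.
Proof.
move=> yr; have [->|y0] := eqVneq (nrm y) 0%R; first by rewrite invr0 mulr0 ln0.
have {}y0 : (0 < nrm y)%R by rewrite lt_neqAle eq_sym y0 qn_ge0.
by rewrite ln_ge0// ler_pdivlMr// mul1r ltW.
Qed.

(** Layer cake: [ln (r / |y|)] is the integral of [1 / t] over [|y| < t < r],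
    so that exchanging the integrals leaves the integral over [0 < t < r] of
    [|B(0,t)| / t].  In terms of volumes, the mean over the ball of
    [ln (|B(0,r)| / |B(0,|y|)|)] is at most one; this is the source of the
    constant [e]. *)
Lemma integral_ln_qball r : (0 < r)%R ->
  \int[m]_(y in qball nrm r) (ln (r / nrm y))%:E <= (ball_volume r / Q)%:E.
Proof.
move=> r0; have Q0 := homogeneous_dim_gt0.
pose h (y : V) (t : R) : \bar R :=
  (\1_(`]-oo, t[ : set R) (nrm y) * t `^ (- 1))%:E.
have h0 y t : 0 <= h y t by rewrite lee_fin mulr_ge0 ?powR_ge0.
have hE y t : h y t = if (nrm y < t)%R then (t `^ (- 1))%:E else 0.
  rewrite /h indicE mem_setE in_itv/=.
  by case: (nrm y < t)%R; rewrite ?mul1r ?mul0r.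
have mh : measurable_fun setT (fun z : V * R => h z.1 z.2).
  rewrite (_ : (fun z => _) = (fun z : V * R =>
      if (nrm z.1 < z.2)%R then (z.2 `^ (- 1))%:E else 0)); last first.
    by apply/funext => z; rewrite hE.
  apply: measurable_fun_ifT => //.
    apply: measurable_fun_ltr; last exact: measurable_snd.
    exact: (measurableT_comp (measurable_quasi_norm nrm)).
  apply/measurable_EFinP.
  exact: (measurableT_comp (measurable_powR _)).
have mB := measurable_qball nrm r.
have mI : measurable (`]0%R, r[ : set R) by exact: measurable_itv.
have lnE y : qball nrm r y ->
    (ln (r / nrm y))%:E <= \int[@lebesgue_R R]_(t in `]0%R, r[) h y t.
  rewrite /qball /= => yr.
  have [->|y0] := eqVneq (nrm y) 0%R.
    by rewrite invr0 mulr0 ln0// integral_ge0.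
  have {}y0 : (0 < nrm y)%R by rewrite lt_neqAle eq_sym y0 qn_ge0.
  rewrite lnM ?posrE ?invr_gt0// lnV ?posrE// -integral_inv_itv//.
  rewrite integral_mkcond [leRHS]integral_mkcond le_eqVlt; apply/orP; left.
  apply/eqP/eq_integral => t _; rewrite !patchE !mem_setE !in_itv/= hE.
  have [yt|ty] := ltP (nrm y) t => /=; last by case: ifP.
  rewrite (lt_trans y0 yt)/=; case: ifP => // _.
  by rewrite powR_inv1// ltW// (lt_trans y0).
apply: (@le_trans _ _ (\int[m]_(y in qball nrm r)
    \int[@lebesgue_R R]_(t in `]0%R, r[) h y t)).
  apply: ge0_le_integral => //.
  - by move=> y yr; rewrite lee_fin ln_ratio_ge0.
  - by apply: measurable_funTS; exact: measurable_ln_ratio.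
  - apply: measurable_funTS.
    exact: (@measurable_fun_integral_ge0 _ _ _ _ _ (@lebesgue_R R) _
      (fun z : V * R => h z.1 z.2)).
rewrite (ge0_tonelli m (@lebesgue_R R))//.
rewrite [leLHS](_ : _ = \int[@lebesgue_R R]_(t in `]0%R, r[)
    ((fine (sigma S) / Q)%:E * (t `^ (Q - 1))%:E)).
  rewrite ge0_integralZl//.
  - by rewrite integral_powR_itv0// -EFinM /ball_volume mulrA.
  - by apply/measurable_EFinP; apply: measurable_funTS; exact: measurable_powR.
  - by move=> t _; rewrite lee_fin powR_ge0.
  - by rewrite lee_fin divr_ge0 ?ltW ?fine_sphere_gt0.
apply: eq_integral => t; rewrite inE/= in_itv/= => /andP[t0 tr].
transitivity (\int[m]_(y in qball nrm r)
    ((t `^ (- 1))%:E * (\1_(qball nrm t) y)%:E)).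
  apply: eq_integral => y _; rewrite hE indicE mem_qball.
  by case: ifP; rewrite ?mule1 ?mule0.
rewrite ge0_integralZl//; last 2 first.
- apply/measurable_EFinP; apply: measurable_funTS; apply: measurable_indic.
  exact: measurable_qball.
- by rewrite lee_fin powR_ge0.
rewrite integral_indic//; last exact: measurable_qball.
rewrite setIidl; last by move=> y; rewrite /qball/= => /lt_trans; apply.
transitivity ((t `^ (- 1))%:E * (ball_volume t)%:E).
  by congr (_ * _); exact: measure_qball.
rewrite -!EFinM /ball_volume mulrCA; congr (_ * _)%:E.
by rewrite (addrC Q) powRD// (gt_eqF t0) implybT.
Qed.

End volumes.

(** * Jensen's inequality on a quasi-ball *)

Lemma ln_le_tangent {R : realType} (x k : R) : 0 < x -> 0 < k ->
  ln x <= x / k - 1 + ln k.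
Proof.
move=> x0 k0; have xk : 0 < x / k by rewrite divr_gt0.
have := @le_ln1Dx R (x / k - 1); rewrite addrCA subrr addr0.
rewrite lnM ?posrE ?invr_gt0// lnV ?posrE// => le1.
by rewrite -lerBlDr; apply: le1; rewrite ltrBrDr addNr.
Qed.

(** From [s ln x = ln (x h^s) + (s - 1) ln x - s ln h]: the two logarithms are
    bounded by their tangents at [k1] and [k2].  Averaged, this is Jensen's
    inequality for [x h^s] and for [x] separately, so that the weight enters
    with the power [s], whose tail integral in [hardy_tail] is [1 / s]. *)
Lemma ln_le_weighted_tangents {R : realType} (s x h k1 k2 : R) :
  1 <= s -> 0 < x -> 0 < h -> 0 < k1 -> 0 < k2 ->
  s * ln x <= (x * h `^ s / k1 - 1 + ln k1) +
    (s - 1) * (x / k2 - 1 + ln k2) - s * ln h.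
Proof.
move=> s1 x0 h0 k10 k20.
have hs0 : 0 < h `^ s by rewrite powR_gt0.
have := @ln_le_tangent R (x * h `^ s) k1 (mulr_gt0 x0 hs0) k10.
rewrite lnM ?posrE// ln_powR => le1.
have le2 := ln_le_tangent x0 k20.
have s10 : 0 <= s - 1 by rewrite subr_ge0.
have := ler_wpM2l s10 le2; move: le1; lra.
Qed.


Section means.
Local Open Scope ereal_scope.
Context {R : realType} {N : nat} (G : homogeneous_group R N)
  (nrm : quasi_norm G).
Local Notation V := 'rV[R]_N.
Local Notation m := (lebesgue_rV R N).

Lemma measurable_integral_qball (k : V -> \bar R) :
  measurable_fun setT k -> (forall x, 0 <= k x) ->
  measurable_fun setT (fun r => \int[m]_(y in qball nrm r) k y).
Proof.
move=> mk k0.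
pose h (z : R * V) : \bar R := if (nrm z.2 < z.1)%R then k z.2 else 0.
rewrite (_ : (fun r => _) = fun r => \int[m]_y h (r, y)).
  apply: measurable_fun_integral_ge0 => //.
    apply: measurable_fun_ifT => //; last exact: (measurableT_comp mk).
    apply: measurable_fun_ltr => //.
    exact: (measurableT_comp (measurable_quasi_norm nrm)).
  by move=> r y _; rewrite /h; case: ifP.
apply/funext => r; rewrite integral_mkcond; apply: eq_integral => y _.
by rewrite patchE /h /= mem_qball.
Qed.

Lemma measurable_mean_qball (w : V -> R) : measurable_fun setT w ->
  measurable_fun setT (mean_qball nrm w).
Proof.
move=> mw.
have mEw : measurable_fun setT (EFin \o w) by exact/measurable_EFinP.
rewrite (_ : mean_qball nrm w = fun r =>
    (fine (\int[m]_(y in qball nrm r) 1) `^ (- 1))%:E *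
    (\int[m]_(y in qball nrm r) (EFin \o w)^\+ y -
     \int[m]_(y in qball nrm r) (EFin \o w)^\- y)).
  apply: emeasurable_funM.
    apply/measurable_EFinP; apply: (measurableT_comp (measurable_powR _)).
    apply: (measurableT_comp (fine_measurable measurableT)).
    exact: measurable_integral_qball.
  apply: emeasurable_funB; apply: measurable_integral_qball => //.
  - exact: measurable_funepos.
  - exact: measurable_funeneg.
apply/funext => r; rewrite /mean_qball integralE.
rewrite integral_cst ?mul1e; last exact: measurable_qball.
by rewrite powR_inv1// fine_ge0.
Qed.

End means.

Section weighted_integrals.
Local Open Scope ereal_scope.
Context {R : realType} {N : nat} (G : homogeneous_group R N)
  (nrm : quasi_norm G).
Local Notation V := 'rV[R]_N.
Local Notation m := (lebesgue_rV R N).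
Local Notation Q := (homogeneous_dim G).
Context (sigma : {measure set V -> \bar R}) (hs : polar_measure nrm sigma)
  (hN : (0 < N)%N).
Local Notation vol := (ball_volume nrm sigma).

Lemma positive_integral_gt0 (g : V -> R) (D : set V) : measurable D ->
  0 < m D -> positive_fun g -> 0 < \int[m]_(x in D) (g x)%:E.
Proof.
move=> mD mD0 [mg g0]; apply: integral_gt0 => //.
  by apply: measurable_funTS; apply/measurable_EFinP.
by move=> x _; rewrite lte_fin.
Qed.

Lemma fine_integral_gt0 (g : V -> R) : positive_fun g ->
  m.-integrable setT (EFin \o g) -> (0 < fine (\int[m]_x (g x)%:E))%R.
Proof.
move=> pg ig.
have g0 := positive_integral_gt0 measurableT lebesgue_rV_gt0 pg.
rewrite fine_gt0// g0/= -ge0_fin_numE ?ltW//.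
exact: integrable_fin_num.
Qed.

Lemma ball_volume_ge0 r : (0 <= vol r)%R.
Proof.
rewrite mulr_ge0 ?powR_ge0// divr_ge0 ?(ltW (fine_sphere_gt0 hs))//.
by rewrite ltW// homogeneous_dim_gt0.
Qed.

Lemma ball_volume_ratio r t : (0 <= r)%R -> (0 < t)%R ->
  (vol r / vol t = (r / t) `^ Q)%R.
Proof.
move=> r0 t0; rewrite /ball_volume -mulf_div divff ?mul1r; last first.
  by rewrite gt_eqF// divr_gt0 ?(fine_sphere_gt0 hs) ?homogeneous_dim_gt0.
have tQ : (t `^ Q != 0)%R by rewrite gt_eqF ?powR_gt0.
apply: (mulIf tQ); rewrite divfK// -powRM ?divr_ge0 ?(ltW t0)//.
by rewrite divfK// gt_eqF.
Qed.

Lemma measurable_ball_volume : measurable_fun setT vol.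
Proof. by apply: measurable_funM => //; exact: measurable_powR. Qed.

(** The integral over [B(0,r)] of [g h^s], where [h(y) = |B(0,|y|)| / |B(0,r)|]
    is at most one. *)
Definition weighted_integral (g : V -> R) (s r : R) : \bar R :=
  \int[m]_(y in qball nrm r) (g y * (vol (nrm y) / vol r) `^ s)%:E.

Lemma measurable_weighted (g : V -> R) r s : measurable_fun setT g ->
  measurable_fun setT (fun y => g y * (vol (nrm y) / vol r) `^ s)%R.
Proof.
move=> mg; apply: measurable_funM => //.
apply: (measurableT_comp (measurable_powR _)); apply: measurable_funM => //.
apply: (measurableT_comp measurable_ball_volume); exact: measurable_quasi_norm.
Qed.

Lemma ball_volume_ratio_le1 (r : R) y : (0 < r)%R -> qball nrm r y ->
  (0 <= vol (nrm y) / vol r <= 1)%R.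
Proof.
move=> r0 yr; rewrite divr_ge0 ?ball_volume_ge0//= ball_volume_ratio ?qn_ge0//.
have -> : (1 = 1 `^ Q :> R)%R by rewrite powR1.
have Q0 := ltW (homogeneous_dim_gt0 G hN).
rewrite ge0_ler_powR ?nnegrE ?divr_ge0 ?qn_ge0 ?(ltW r0)//.
by rewrite ler_pdivrMr// mul1r ltW.
Qed.

Lemma integrable_weighted (g : V -> R) r s : (0 <= s)%R -> (0 < r)%R ->
  (forall y, 0 <= g y)%R -> m.-integrable setT (EFin \o g) ->
  m.-integrable (qball nrm r)
    (fun y => (g y * (vol (nrm y) / vol r) `^ s)%:E).
Proof.
move=> s0 r0 g0 ig.
have mg : measurable_fun setT g.
  by apply/measurable_EFinP; exact: measurable_int ig.
apply: (@le_integrable _ _ _ m _ (measurable_qball nrm r) _ (EFin \o g)).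
- apply/measurable_EFinP; apply: measurable_funTS.
  exact: measurable_weighted.
- move=> y yr /=; rewrite lee_fin !ger0_norm ?mulr_ge0 ?powR_ge0//.
  have /andP[h0 h1] := ball_volume_ratio_le1 r0 yr.
  rewrite ler_piMr//; have -> : (1 = 1 `^ s :> R)%R by rewrite powR1.
  by rewrite ge0_ler_powR// nnegrE.
- apply: integrableS ig => //; exact: measurable_qball.
Qed.

Lemma measure_punctured_qball_gt0 r : (0 < r)%R ->
  0 < m (qball nrm r `\` [set 0%R]).
Proof.
move=> r0.
have m0 := measurable_origin nrm.
have mB := measurable_qball nrm r.
rewrite lt_neqAle measure_ge0 andbT; apply/eqP => mB0.
have : m (qball nrm r) <= 0.
  apply: (@le_trans _ _ (m (qball nrm r `\` [set 0%R]) + m [set 0%R])).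
    apply: (@le_trans _ _ (m ((qball nrm r `\` [set 0%R]) `|` [set 0%R]))).
      apply: le_measure; rewrite ?inE//.
        by apply: measurableU => //; exact: measurableD.
      by move=> y yr; have [->|/eqP y0] := eqVneq y 0%R; [right|left].
    by apply: measureU2 => //; exact: measurableD.
  by rewrite -mB0 add0e; have -> : m [set 0%R] = 0 by exact: lebesgue_rV_origin.
by rewrite (measure_qball hs hN)// lee_fin leNgt (ball_volume_gt0 hs hN).
Qed.

(** The weight vanishes at the origin, hence the detour by the punctured
    ball. *)
Lemma weighted_integral_gt0 (g : V -> R) r s : (0 < r)%R ->
  measurable_fun setT g -> (forall y, 0 < g y)%R ->
  0 < weighted_integral g s r.
Proof.
move=> r0 mg g0.
have m0 := measurable_origin nrm.
have mB := measurable_qball nrm r.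
have mw : measurable_fun setT (fun y => (g y * (vol (nrm y) / vol r) `^ s)%:E).
  by apply/measurable_EFinP; exact: measurable_weighted.
apply: (@lt_le_trans _ _ (\int[m]_(y in qball nrm r `\` [set 0%R])
    (g y * (vol (nrm y) / vol r) `^ s)%:E)).
  apply: integral_gt0.
  - exact: measurableD.
  - exact: measurable_funTS.
  - move=> y [yr /eqP y0]; rewrite lte_fin mulr_gt0// powR_gt0// divr_gt0//.
      by apply: (ball_volume_gt0 hs hN); exact: quasi_norm_gt0.
    exact: (ball_volume_gt0 hs hN).
  - exact: measure_punctured_qball_gt0.
apply: ge0_subset_integral => //.
- exact: measurableD.
- exact: measurable_funTS.
- by move=> y _; rewrite lee_fin mulr_ge0 ?powR_ge0// ltW.
Qed.

End weighted_integrals.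

Section log_majorant.
Local Open Scope ereal_scope.
Context {R : realType} {N : nat} (G : homogeneous_group R N)
  (nrm : quasi_norm G).
Local Notation V := 'rV[R]_N.
Local Notation m := (lebesgue_rV R N).
Local Notation Q := (homogeneous_dim G).
Context (sigma : {measure set V -> \bar R}) (hs : polar_measure nrm sigma)
  (hN : (0 < N)%N).
Local Notation vol := (ball_volume nrm sigma).

Local Notation weighted_integral := (weighted_integral nrm sigma).

Lemma ae_quasi_norm_gt0 (P : V -> Prop) : (forall y, (0 < nrm y)%R -> P y) ->
  {ae m, forall y, P y}.
Proof.
move=> PP; exists [set 0%R : V]; split.
- exact: (measurable_origin nrm).
- exact: lebesgue_rV_origin.
- move=> y /= nPy; apply: contrapT => /eqP y0; apply: nPy; apply: PP.
  exact: quasi_norm_gt0.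
Qed.

Lemma integrable_ln_qball r : (0 < r)%R ->
  m.-integrable (qball nrm r) (fun y => (ln (r / nrm y))%:E).
Proof.
move=> r0; apply/integrableP; split.
  by apply: measurable_funTS; exact: measurable_ln_ratio.
apply: le_lt_trans (ltry (vol r / Q)).
apply: le_trans (integral_ln_qball hs hN r0).
rewrite le_eqVlt; apply/orP; left; apply/eqP/eq_integral => y /[!inE] yr.
by rewrite gee0_abs// lee_fin ln_ratio_ge0.
Qed.

Lemma weighted_integral_fin (g : V -> R) s r : (0 <= s)%R -> (0 < r)%R ->
  (forall y, 0 <= g y)%R -> m.-integrable setT (EFin \o g) ->
  weighted_integral g s r \is a fin_num.
Proof.
move=> s0 r0 g0 ig.
exact: (integrable_fin_num (measurable_qball nrm r)
  (integrable_weighted hs hN s0 r0 g0 ig)).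
Qed.

(** [ln_le_weighted_tangents] on the ball, with the tangent points chosen as the
    means of [g h^s] and of [g] (the latter over-estimated by the integral over
    the whole group); the mean of [- ln h] is at most one. *)
Lemma exists_log_majorant (g : V -> R) (s r : R) : (1 <= s)%R -> (0 < r)%R ->
  positive_fun g -> m.-integrable setT (EFin \o g) ->
  exists k : V -> R,
  [/\ m.-integrable (qball nrm r) (EFin \o k),
      \int[m]_(y in qball nrm r) (k y)%:E <=
        (vol r * (ln (fine (weighted_integral g s r) / vol r) +
          (s - 1) * ln (fine (\int[m]_y (g y)%:E) / vol r) + s))%:E &
      {ae m, forall y, qball nrm r y -> (s * ln (g y) <= k y)%R}].
Proof.
move=> s1 r0 [mg g0] ig; have s0 : (0 < s)%R by exact: lt_le_trans s1.
have mB := measurable_qball nrm r.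
have t0 := ball_volume_gt0 hs hN r0.
have Q0 := homogeneous_dim_gt0 G hN.
have g0' y : (0 <= g y)%R by exact: ltW.
have Jfin := weighted_integral_fin (ltW s0) r0 g0' ig.
have J0 := weighted_integral_gt0 hs hN s r0 mg g0.
set J := fine (weighted_integral g s r).
have JE : weighted_integral g s r = J%:E by rewrite fineK.
have {}J0 : (0 < J)%R by rewrite -lte_fin -JE.
have Afin : \int[m]_y (g y)%:E \is a fin_num by apply: integrable_fin_num.
set A := fine (\int[m]_y (g y)%:E).
have AE : \int[m]_y (g y)%:E = A%:E by rewrite fineK.
have iB : m.-integrable (qball nrm r) (EFin \o g) by exact: integrableS ig.
have ABfin : \int[m]_(y in qball nrm r) (g y)%:E \is a fin_num.
  exact: integrable_fin_num.
set AB := fine (\int[m]_(y in qball nrm r) (g y)%:E).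
have ABE : \int[m]_(y in qball nrm r) (g y)%:E = AB%:E by rewrite fineK.
have ABA : (AB <= A)%R.
  rewrite -lee_fin -ABE -AE; apply: ge0_subset_integral => //.
    by apply/measurable_EFinP.
  by move=> y _; rewrite lee_fin.
have A0 : (0 < A)%R.
  exact: fine_integral_gt0.
have iL := integrable_ln_qball r0.
have Lfin : \int[m]_(y in qball nrm r) (ln (r / nrm y))%:E \is a fin_num.
  exact: integrable_fin_num.
set L := fine (\int[m]_(y in qball nrm r) (ln (r / nrm y))%:E).
have LE : \int[m]_(y in qball nrm r) (ln (r / nrm y))%:E = L%:E.
  by rewrite fineK.
have Lle : (L <= vol r / Q)%R.
  rewrite -lee_fin -LE; exact: (integral_ln_qball hs hN r0).
set t := vol r in t0 Lle *.
pose k1 := (J / t)%R; pose k2 := (A / t)%R.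
have k10 : (0 < k1)%R by rewrite divr_gt0.
have k20 : (0 < k2)%R by rewrite divr_gt0.
pose c := (ln k1 - 1 + (s - 1) * (ln k2 - 1))%R.
pose F1 y := ((k1^-1)%:E * (g y * (vol (nrm y) / t) `^ s)%:E).
pose F2 y := (((s - 1) / k2)%:E * (g y)%:E).
pose F3 y := ((s * Q)%:E * (ln (r / nrm y))%:E).
have iW := integrable_weighted hs hN (ltW s0) r0 g0' ig.
have i1 : m.-integrable (qball nrm r) F1 by exact: integrableZl.
have i2 : m.-integrable (qball nrm r) F2 by exact: integrableZl.
have i3 : m.-integrable (qball nrm r) F3 by exact: integrableZl.
have mBoo : m (qball nrm r) < +oo.
  have -> : m (qball nrm r) = t%:E by exact: (measure_qball hs hN r0).
  exact: ltry.
have i4 : m.-integrable (qball nrm r) (EFin \o (cst c)).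
  apply: measurable_bounded_integrable => //.
  exact: bounded_cst.
have i12 := integrableD mB i1 i2.
have i34 := integrableD mB i3 i4.
exists (fun y => k1^-1 * (g y * (vol (nrm y) / t) `^ s) + (s - 1) / k2 * g y +
  (s * Q * ln (r / nrm y) + c))%R; split.
- exact: (integrableD mB i12 i34).
- rewrite [leLHS](_ : _ = (k1^-1)%:E * J%:E + ((s - 1) / k2)%:E * AB%:E +
      ((s * Q)%:E * L%:E + c%:E * t%:E)).
    rewrite -!EFinM -!EFinD lee_fin /c.
    have -> : (k1^-1 * J = t)%R by rewrite /k1 invf_div divfK// gt_eqF.
    have h2 : ((s - 1) / k2 * AB <= (s - 1) * t)%R.
      rewrite /k2 invf_div -mulrA ler_wpM2l ?subr_ge0//.
      by rewrite -mulrA ler_piMr ?(ltW t0)// mulrC ler_pdivrMr// mul1r.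
    have h3 : (s * Q * L <= s * t)%R.
      rewrite -mulrA ler_pM2l// mulrC -ler_pdivlMr//.
    nra.
  rewrite -JE -ABE -LE.
  rewrite -(integralZl mB iW) -(integralZl mB iB) -(integralZl mB iL).
  have <- : \int[m]_(y in qball nrm r) (EFin \o cst c) y = c%:E * t%:E.
    transitivity (\int[m]_(y in qball nrm r) (cst c%:E y)) => //.
    rewrite integral_cst//; congr (_ * _); exact: (measure_qball hs hN r0).
  rewrite -(integralD mB i1 i2) -(integralD mB i3 i4) -(integralD mB i12 i34).
  by apply: eq_integral.
- apply: ae_quasi_norm_gt0 => y y0 yr.
  have h0 : (0 < vol (nrm y) / t)%R.
    by rewrite divr_gt0// (ball_volume_gt0 hs hN).
  have := ln_le_weighted_tangents s1 (g0 y) h0 k10 k20.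
  have -> : (ln (vol (nrm y) / t) = - (Q * ln (r / nrm y)))%R.
    rewrite /t (ball_volume_ratio hs hN)// ?(ltW y0)// ln_powR -mulrN.
    congr (_ * _)%R.
    by rewrite !lnM ?posrE ?invr_gt0// !lnV ?posrE// opprD opprK addrC.
  rewrite /c; lra.
Qed.

End log_majorant.

(** * The pointwise estimate of the geometric mean *)

Section pointwise_estimate.
Local Open Scope ereal_scope.
Context {R : realType} {N : nat} (G : homogeneous_group R N)
  (nrm : quasi_norm G).
Local Notation V := 'rV[R]_N.
Local Notation m := (lebesgue_rV R N).
Local Notation Q := (homogeneous_dim G).
Context (sigma : {measure set V -> \bar R}) (hs : polar_measure nrm sigma)
  (hN : (0 < N)%N).
Local Notation vol := (ball_volume nrm sigma).
Local Notation S := (qsphere nrm).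
Local Notation wint := (weighted_integral nrm sigma).

Lemma mean_qballE (w : V -> R) r : (0 < r)%R ->
  mean_qball nrm w r = (vol r)^-1%:E * \int[m]_(y in qball nrm r) (w y)%:E.
Proof. by move=> r0; rewrite /mean_qball (measure_qball hs hN). Qed.

Lemma measurable_ln_positive (f : V -> R) : positive_fun f ->
  measurable_fun setT (fun y => ln (f y)).
Proof. by move=> [mf _]; exact: (measurableT_comp (@measurable_ln R)). Qed.

Lemma ln_inv_positive (v : V -> R) : positive_fun v ->
  (fun y => ln (v y)^-1) = (fun y => - ln (v y))%R.
Proof. by move=> [_ v0]; apply/funext => y; rewrite lnV ?posrE. Qed.

Lemma positive_weighted_power (p : R) (f v : V -> R) :
  positive_fun f -> positive_fun v -> positive_fun (fun y => f y `^ p * v y)%R.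
Proof.
move=> [mf f0] [mv v0]; split; last by move=> y; rewrite mulr_gt0 ?powR_gt0.
apply: measurable_funM => //; exact: (measurableT_comp (measurable_powR _)).
Qed.

(** Since [f^q = g^s (1 / v)^s], the geometric mean of [f] is controlled by
    those of [g], estimated by [exists_log_majorant], and of [1 / v].  The last
    hypothesis excludes an infinite geometric mean of [1 / v]; if that mean is
    zero then so is that of [f]. *)
Lemma geometric_mean_le (p q : R) (f v : V -> R) (r : R) :
  (0 < p)%R -> (p <= q)%R -> (0 < r)%R -> positive_fun f -> positive_fun v ->
  let g := (fun y => f y `^ p * v y)%R in
  let s := (q / p)%R in
  m.-integrable setT (EFin \o g) ->
  \int[m]_(y in qball nrm r) (ln (v y)^-1)%:E < +oo ->
  expeR (mean_qball nrm (fun y => ln (f y)) r) `^ q <=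
  (expR s * (fine (wint g s r) / vol r) *
    (fine (\int[m]_y (g y)%:E) / vol r) `^ (s - 1))%:E *
  expeR (mean_qball nrm (fun y => ln (v y)^-1) r) `^ s.
Proof.
move=> p0 pq r0 pf pv g s ig voo.
have q0 : (0 < q)%R by exact: lt_le_trans pq.
have pN0 : (p != 0)%R by rewrite gt_eqF.
have qN0 : (q != 0)%R by rewrite gt_eqF.
have s1 : (1 <= s)%R by rewrite ler_pdivlMr// mul1r.
have s0 : (0 < s)%R by exact: lt_le_trans s1.
have pg : positive_fun g by exact: positive_weighted_power.
have [k [ik kle kge]] := exists_log_majorant hs hN s1 r0 pg ig.
have mB := measurable_qball nrm r.
have t0 := ball_volume_gt0 hs hN r0.
have J0 : (0 < fine (wint g s r))%R.
  rewrite fine_gt0// (weighted_integral_gt0 hs hN s r0 pg.1 pg.2)/=.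
  rewrite -ge0_fin_numE; last first.
    exact/ltW/(weighted_integral_gt0 hs hN s r0 pg.1 pg.2).
  by apply: (weighted_integral_fin hs hN (ltW s0) r0 _ ig) => y; exact/ltW/pg.2.
have A0 : (0 < fine (\int[m]_y (g y)%:E))%R.
  exact: fine_integral_gt0.
move: kle; set J := fine (wint g s r) in J0 *.
set A := fine (\int[m]_y (g y)%:E) in A0 *.
set t := vol r in t0 *; move=> kle.
pose k' y := (k y / q)%R.
have ik' : m.-integrable (qball nrm r) (EFin \o k').
  have := integrableZr mB q^-1 ik; apply: eq_integrable => // y _.
have k'E : \int[m]_(y in qball nrm r) (k' y)%:E =
    \int[m]_(y in qball nrm r) (k y)%:E * (q^-1)%:E.
  by rewrite -(integralZr mB ik).
have := @integral_le_affine _ _ _ m _ mB (fun y => ln (f y))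
  (fun y => ln (v y)^-1) k' p^-1.
rewrite invr_gt0 => /(_ p0).
have mlnf : measurable_fun (qball nrm r) (fun y => ln (f y)).
  by apply: measurable_funTS; exact: measurable_ln_positive.
have mlnv : measurable_fun (qball nrm r) (fun y => ln (v y)^-1).
  rewrite (ln_inv_positive pv); apply: measurable_funTS.
  by apply: measurableT_comp => //; exact: measurable_ln_positive.
move=> /(_ mlnf mlnv ik' voo).
have le_ae : {ae m, forall y, qball nrm r y ->
    (ln (f y) <= p^-1 * ln (v y)^-1 + k' y)%R}.
  apply: filterS kge => y + yr => /(_ yr).
  have f0 := pf.2 y; have v0 := pv.2 y.
  rewrite /g lnM ?posrE ?powR_gt0// ln_powR lnV ?posrE// /k' /s => le1.
  rewrite -(ler_pM2l q0).
  have -> : (q * (p^-1 * - ln (v y) + k y / q) = q / p * - ln (v y) + k y)%R.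
    by field; rewrite ?pN0 ?qN0.
  have e1 : (q / p * (p * ln (f y) + ln (v y)) =
      q * ln (f y) + q / p * ln (v y))%R.
    by field; rewrite ?pN0 ?qN0.
  move: le1; rewrite e1; lra.
move=> /(_ le_ae); rewrite k'E.
have kfin : \int[m]_(y in qball nrm r) (k y)%:E \is a fin_num.
  exact: integrable_fin_num.
move: kle; rewrite -(fineK kfin); set K := fine _; rewrite lee_fin => kle.
rewrite !mean_qballE// -/t.
case: (\int[m]_(y in qball nrm r) (ln (v y)^-1)%:E) voo => [I _||_] //;
    last first.
  rewrite gt0_muleNy ?lte_fin ?invr_gt0// addNye leeNy_eq => /eqP ->.
  rewrite gt0_muleNy ?lte_fin ?invr_gt0//= powR0 ?gt_eqF//.
  rewrite mule_ge0 ?poweR_ge0// lee_fin.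
  by rewrite !mulr_ge0 ?expR_ge0 ?powR_ge0 ?invr_ge0 ?ltW.
case: (\int[m]_(y in qball nrm r) (ln (f y))%:E) => [a||] //; last first.
  rewrite gt0_muleNy ?lte_fin ?invr_gt0//= powR0 ?gt_eqF// => _.
  rewrite mule_ge0 ?poweR_ge0// lee_fin.
  by rewrite !mulr_ge0 ?expR_ge0 ?powR_ge0 ?invr_ge0 ?ltW.
rewrite -!EFinM -EFinD lee_fin => le_a /=.
rewrite lee_fin -!expRM.
have -> : (J / t = expR (ln (J / t)))%R by rewrite lnK// posrE divr_gt0.
have -> : ((A / t) `^ (s - 1) = expR ((s - 1) * ln (A / t)))%R.
  by rewrite -ln_powR lnK// posrE powR_gt0// divr_gt0.
rewrite -!expRD ler_expR.
set b := (ln (J / t)) in kle *; set c := (ln (A / t)) in kle *.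
have le2 : (q * a <= s * I + K)%R.
  have := le_a; rewrite -(ler_pM2l q0).
  have -> : (q * (p^-1 * I + K / q) = s * I + K)%R => //.
  by rewrite /s; field; rewrite ?pN0 ?qN0.
have le3 : (q * a <= s * I + t * (b + (s - 1) * c + s))%R.
  by rewrite (le_trans le2)// lerD2l.
have -> : (t^-1 * a * q = t^-1 * (q * a))%R by ring.
rewrite mulrC ler_pdivrMr//; apply: (le_trans le3).
by rewrite le_eqVlt; apply/orP; left; apply/eqP; field; rewrite gt_eqF.
Qed.

End pointwise_estimate.

Section weighted_bound.
Local Open Scope ereal_scope.
Context {R : realType} {N : nat} (G : homogeneous_group R N)
  (nrm : quasi_norm G).
Local Notation V := 'rV[R]_N.
Local Notation m := (lebesgue_rV R N).
Local Notation Q := (homogeneous_dim G).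
Context (sigma : {measure set V -> \bar R}) (hs : polar_measure nrm sigma)
  (hN : (0 < N)%N).
Local Notation vol := (ball_volume nrm sigma).
Local Notation S := (qsphere nrm).
Local Notation wint := (weighted_integral nrm sigma).
Local Notation sS := (fine (sigma S)).

Lemma qsphere_nonempty : S !=set0.
Proof.
apply/set0P/eqP => S0; have := sphere_measure_gt0 hs.
by rewrite S0 measure0 ltxx.
Qed.

Lemma sphere_integral_gt0 (u : V -> R) r : positive_fun u ->
  0 < \int[sigma]_(y in S) (u (dil G r y))%:E.
Proof.
move=> [mu u0]; apply: integral_gt0.
- exact: measurable_qsphere.
- apply: measurable_funTS; apply/measurable_EFinP.
  by apply: (measurableT_comp mu); exact: measurable_dil.
- by move=> y _; rewrite lte_fin.
- exact: sphere_measure_gt0 hs.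
Qed.

(** The bound given by [D_const] at a point of the sphere of radius [r], raised
    to the power [q].  As the spherical mean of [u] is positive, finiteness of
    [D_const] prevents the geometric mean of [1 / v] from being infinite, and
    the spherical mean of [u] from being infinite unless the geometric mean of
    [1 / v] vanishes. *)
Lemma D_const_radial_bound (p q : R) (u v : V -> R) (r : R) :
  (0 < p)%R -> (p <= q)%R -> positive_fun u -> positive_fun v ->
  D_const nrm sigma p q u v < +oo -> (0 < r)%R ->
  \int[m]_(y in qball nrm r) (ln (v y)^-1)%:E < +oo /\
  expeR (mean_qball nrm (fun y => ln (v y)^-1) r) `^ (q / p) *
    \int[sigma]_(y in S) (u (dil G r y))%:E <=
  (fine (D_const nrm sigma p q u v) `^ q * sS * vol r `^ (q / p - 1))%:E.
Proof.
move=> p0 pq pu pv Doo r0.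
have q0 : (0 < q)%R by exact: lt_le_trans pq.
have pN0 : (p != 0)%R by rewrite gt_eqF.
have qN0 : (q != 0)%R by rewrite gt_eqF.
have t0 := ball_volume_gt0 hs hN r0.
have sS0 := fine_sphere_gt0 hs.
have U0 := sphere_integral_gt0 r pu.
have [y0 Sy0] := qsphere_nonempty.
have nx : nrm (dil G r y0) = r by exact: qn_dil_qsphere.
have xN0 : dil G r y0 != 0%R.
  apply/eqP => /(qn_eq0 nrm); rewrite nx => r00.
  by rewrite r00 ltxx in r0.
have : (vol r `^ (q^-1 - p^-1))%:E * (sS^-1%:E *
    \int[sigma]_(y in S) (u (dil G r y))%:E) `^ q^-1 *
    expeR (mean_qball nrm (fun y => ln (v y)^-1) r) `^ p^-1 <=
    D_const nrm sigma p q u v.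
  apply: ereal_sup_ubound; exists (dil G r y0) => //.
  by rewrite /spherical_mean /geometric_mean nx (measure_qball hs hN).
set U := \int[sigma]_(y in S) _ in U0 *.
rewrite (mean_qballE hs hN)//; move: (vol r) t0 => t t0.
have dr0 : (0 < t `^ (q^-1 - p^-1))%R by rewrite powR_gt0.
have [D Dfin] : exists D, D_const nrm sigma p q u v = D%:E \/
    D_const nrm sigma p q u v = -oo.
  case: (D_const _ _ _ _ _ _) Doo => [D| |]//.
    by exists D; left.
  by exists 0%R; right.
have b0 : 0 < (sS^-1%:E * U) `^ q^-1.
  rewrite lt_neqAle poweR_ge0 andbT eq_sym poweR_eq0; last first.
    by rewrite mule_ge0 ?lee_fin ?invr_ge0 ?ltW.
  by rewrite negb_and mule_eq0 negb_or eqe gt_eqF ?invr_gt0//= gt_eqF.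
have ab0 : 0 < (t `^ (q^-1 - p^-1))%:E * (sS^-1%:E * U) `^ q^-1.
  by rewrite mule_gt0// lte_fin.
case: (\int[m]_(y in qball nrm r) (ln (v y)^-1)%:E) => [I||].
- rewrite -EFinM /= => leD; split; first exact: ltry.
  set M := expR _ in leD *; have M0 : (0 < M)%R by exact: expR_gt0.
  have Moo : 0 < (M `^ p^-1)%:E by rewrite lte_fin powR_gt0.
  move: leD U0 b0 ab0; case: U => [U||] //; last first.
    rewrite gt0_muley ?lte_fin ?invr_gt0//= invr_eq0 (negbTE qN0).
    rewrite gt0_muley ?lte_fin// gt0_mulye// => + _ _ _.
    by rewrite leye_eq => /eqP DE; rewrite DE ltxx in Doo.
  rewrite -!EFinM /= => leD; rewrite lte_fin => U0 b0 ab0.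
  case: Dfin => DE; last by rewrite DE in leD.
  rewrite DE /= lee_fin; move: leD; rewrite DE lee_fin => leD.
  have D0 : (0 <= D)%R.
    by apply: le_trans leD; rewrite !mulr_ge0 ?powR_ge0.
  have : ((t `^ (q^-1 - p^-1) * (sS^-1 * U) `^ q^-1 * M `^ p^-1) `^ q
      <= D `^ q)%R.
    rewrite ge0_ler_powR ?nnegrE ?(ltW q0)//.
    by rewrite !mulr_ge0 ?powR_ge0.
  rewrite !powRM ?mulr_ge0 ?powR_ge0 ?invr_ge0 ?(ltW U0) ?(ltW sS0)//.
  rewrite -!powRrM (mulVf qN0) !powRr1 ?invr_ge0 ?(ltW U0) ?(ltW sS0)//.
  rewrite mulrBl (mulVf qN0) [(p^-1 * q)%R]mulrC.
  have -> : (1 - q / p = - (q / p - 1))%R by ring.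
  rewrite powRN => le1.
  have ts0 : (0 < t `^ (q / p - 1))%R by rewrite powR_gt0.
  have -> : (M `^ (q / p) * U = ((t `^ (q / p - 1))^-1 * (sS^-1 * U) *
      M `^ (q / p)) * (sS * t `^ (q / p - 1)))%R.
    by field; rewrite !gt_eqF.
  by rewrite -[leRHS]mulrA ler_pM2r// mulr_gt0.
- rewrite gt0_muley ?lte_fin ?invr_gt0//= invr_eq0 (negbTE pN0) gt0_muley//.
  by rewrite leye_eq => /eqP DE; rewrite DE ltxx in Doo.
- rewrite gt0_muleNy ?lte_fin ?invr_gt0//= => _; split=> //.
  rewrite powR0 ?mul0e; first by rewrite lee_fin !mulr_ge0 ?powR_ge0// ltW.
  by rewrite mulf_neq0// invr_eq0.
Qed.

Lemma pointwise_bound (p q : R) (u v f : V -> R) (r : R) :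
  (0 < p)%R -> (p <= q)%R -> positive_fun u -> positive_fun v ->
  D_const nrm sigma p q u v < +oo -> positive_fun f -> (0 < r)%R ->
  let g := (fun y => f y `^ p * v y)%R in
  let s := (q / p)%R in
  m.-integrable setT (EFin \o g) ->
  expeR (mean_qball nrm (fun y => ln (f y)) r) `^ q *
    \int[sigma]_(y in S) (u (dil G r y))%:E <=
  (fine (D_const nrm sigma p q u v) `^ q * sS * expR s *
    fine (\int[m]_y (g y)%:E) `^ (s - 1))%:E *
  ((vol r)^-1%:E * wint g s r).
Proof.
move=> p0 pq pu pv Doo pf r0 g s ig.
have q0 : (0 < q)%R by exact: lt_le_trans pq.
have s0 : (0 < s)%R by rewrite divr_gt0.
have t0 := ball_volume_gt0 hs hN r0.
have [voo leD] := D_const_radial_bound p0 pq pu pv Doo r0.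
have le1 := geometric_mean_le hs hN p0 pq r0 pf pv ig voo.
have U0 := ltW (sphere_integral_gt0 r pu).
have pg : positive_fun g by exact: positive_weighted_power.
have g0 y : (0 <= g y)%R by exact/ltW/pg.2.
have Jfin := weighted_integral_fin hs hN (ltW s0) r0 g0 ig.
have J0 : (0 <= fine (wint g s r))%R.
  rewrite fine_ge0// integral_ge0// => y _.
  by rewrite lee_fin mulr_ge0 ?powR_ge0.
have A0 : (0 <= fine (\int[m]_y (g y)%:E))%R.
  by rewrite fine_ge0// integral_ge0// => y _; rewrite lee_fin.
apply: (le_trans (lee_wpmul2r U0 le1)).
rewrite -muleA -(fineK Jfin).
set J := fine (wint _ _ _) in J0 *; set A := fine (\int[m]_y _) in A0 *.
have c0 : (0 <= expR s * (J / vol r) * (A / vol r) `^ (s - 1))%R.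
  by rewrite !mulr_ge0 ?expR_ge0 ?powR_ge0 ?invr_ge0 ?(ltW t0).
apply: (le_trans (lee_wpmul2l _ leD)); first by rewrite lee_fin.
rewrite -!EFinM lee_fin le_eqVlt; apply/orP; left; apply/eqP.
have AE : (A `^ (s - 1) = (A / vol r) `^ (s - 1) * vol r `^ (s - 1))%R.
  by rewrite -powRM ?divr_ge0 ?(ltW t0)// divfK// gt_eqF.
rewrite -/s AE /=; ring.
Qed.

End weighted_bound.

(** * The integral inequality *)

Section main_bound.
Local Open Scope ereal_scope.
Context {R : realType} {N : nat} (G : homogeneous_group R N)
  (nrm : quasi_norm G).
Local Notation V := 'rV[R]_N.
Local Notation m := (lebesgue_rV R N).
Local Notation lam := (@lebesgue_R R).
Local Notation Q := (homogeneous_dim G).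
Context (sigma : {measure set V -> \bar R}) (hs : polar_measure nrm sigma)
  (hN : (0 < N)%N).
Local Notation vol := (ball_volume nrm sigma).
Local Notation S := (qsphere nrm).
Local Notation wint := (weighted_integral nrm sigma).
Local Notation sS := (fine (sigma S)).

Lemma tail_integral (s r : R) : (0 < s)%R -> (0 < r)%R ->
  \int[lam]_(t in `]r, +oo[) (t `^ (Q - 1) * vol t `^ (- s - 1))%:E =
  ((vol r `^ s * (s * sS))^-1)%:E.
Proof.
move=> s0 r0; have Q0 := homogeneous_dim_gt0 G hN.
have sS0 := fine_sphere_gt0 hs.
have c0 : (0 < sS / Q)%R by rewrite divr_gt0.
have volE t a : (vol t `^ a = (sS / Q) `^ a * t `^ (Q * a))%R.
  by rewrite /ball_volume [LHS]powRM ?powR_ge0 ?(ltW c0)// -powRrM.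
transitivity (\int[lam]_(t in `]r, +oo[)
    (((sS / Q) `^ (- s - 1))%:E * (t `^ (- (Q * s) - 1))%:E)).
  apply: eq_integral => t; rewrite inE/= in_itv/= andbT => rt.
  have t0 : (0 < t)%R by exact: lt_trans rt.
  rewrite -EFinM; congr EFin.
  rewrite volE mulrCA; congr (_ * _)%R.
  rewrite -powRD; last by rewrite (gt_eqF t0) implybT.
  by congr (_ `^ _)%R; ring.
rewrite ge0_integralZl//; last 3 first.
- by apply/measurable_EFinP; apply: measurable_funTS; exact: measurable_powR.
- by move=> t _; rewrite lee_fin powR_ge0.
- by rewrite lee_fin powR_ge0.
rewrite integral_powR_itvy ?mulr_gt0// -EFinM; congr EFin.
rewrite volE powRN.
have -> : (- s - 1 = - (s + 1))%R by ring.
rewrite powRN powRD; last by rewrite (gt_eqF c0) implybT.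
rewrite powRr1 ?(ltW c0)//.
move: (powR_gt0 s c0) (powR_gt0 (Q * s) r0) => /gt_eqF cs /gt_eqF rs.
by field; rewrite ?cs ?rs ?(gt_eqF Q0) ?(gt_eqF s0) ?(gt_eqF sS0).
Qed.

(** After exchanging the integrals, the weight [|B(0,|y|)|^s] cancels the tail
    integral of the power [-s - 1] of the volume. *)
Lemma hardy_tail (g : V -> R) (s : R) : (0 < s)%R -> positive_fun g ->
  \int[lam]_(r in `]0%R, +oo[)
    ((r `^ (Q - 1))%:E * ((vol r)^-1%:E * wint g s r)) <=
  ((s * sS)^-1)%:E * \int[m]_y (g y)%:E.
Proof.
move=> s0 [mg g0]; have sS0 := fine_sphere_gt0 hs.
pose w (y : V) (r : R) : R :=
  (g y * vol (nrm y) `^ s * (r `^ (Q - 1) * vol r `^ (- s - 1)))%R.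
pose W (r : R) (y : V) : \bar R := if (nrm y < r)%R then (w y r)%:E else 0.
have vol_ge0 r : (0 <= vol r)%R by exact: ball_volume_ge0 hs hN r.
have w0 y r : (0 <= w y r)%R.
  by rewrite !mulr_ge0 ?powR_ge0// ltW.
have mnrm := measurable_quasi_norm nrm.
have mvol : measurable_fun setT vol by exact: measurable_ball_volume.
have mw : measurable_fun setT (fun z : R * V => w z.2 z.1).
  apply: measurable_funM; apply: measurable_funM.
  - exact: (measurableT_comp mg).
  - apply: (measurableT_comp (measurable_powR _)).
    apply: (measurableT_comp mvol); exact: (measurableT_comp mnrm).
  - exact: (measurableT_comp (measurable_powR _)).
  - apply: (measurableT_comp (measurable_powR _)).
    exact: (measurableT_comp mvol).
have mW : measurable_fun setT (fun z : R * V => W z.1 z.2).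
  apply: measurable_fun_ifT => //; last exact/measurable_EFinP.
  by apply: measurable_fun_ltr => //; exact: (measurableT_comp mnrm).
have W0 r y : 0 <= W r y by rewrite /W; case: ifP => // _; rewrite lee_fin.
have mI : measurable (`]0%R, +oo[ : set R) by exact: measurable_itv.
have -> : \int[lam]_(r in `]0%R, +oo[)
    ((r `^ (Q - 1))%:E * ((vol r)^-1%:E * wint g s r)) =
    \int[lam]_(r in `]0%R, +oo[) \int[m]_y W r y.
  apply: eq_integral => r; rewrite inE/= in_itv/= andbT => r0.
  have v0 := ball_volume_gt0 hs hN r0.
  have mB := measurable_qball nrm r.
  rewrite muleA -EFinM /weighted_integral -ge0_integralZl//.
  - rewrite integral_mkcond; apply: eq_integral => y _; rewrite patchE /W.
    rewrite mem_qball; case: ifP => // yr.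
    rewrite -EFinM; congr EFin; rewrite /w.
    rewrite powRM ?invr_ge0 ?vol_ge0//.
    have -> : ((vol r)^-1 `^ s = (vol r `^ s)^-1)%R.
      by rewrite -powR_inv1 ?vol_ge0// -powRrM mulN1r powRN.
    have -> : (- s - 1 = - (s + 1))%R by ring.
    rewrite powRN [(vol r `^ (s + 1))%R]powRD; last first.
      by rewrite (gt_eqF v0) implybT.
    rewrite powRr1 ?vol_ge0// [((_ * vol r)^-1)%R]invfM.
    by ring.
  - apply/measurable_EFinP; apply: measurable_funTS.
    exact: measurable_weighted.
  - by move=> y _; rewrite lee_fin mulr_ge0 ?powR_ge0// ltW.
  - by rewrite lee_fin mulr_ge0 ?powR_ge0// invr_ge0 vol_ge0.
rewrite (ge0_tonelli lam m)//.
rewrite -ge0_integralZl//; last 3 first.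
- exact/measurable_EFinP.
- by move=> y _; rewrite lee_fin ltW.
- by rewrite lee_fin invr_ge0 mulr_ge0 ?ltW.
apply: ge0_le_integral => //.
- by move=> y _; exact: integral_ge0.
- apply: (@measurable_fun_integral_ge0 _ _ _ _ _ lam _
    (fun z : V * R => W z.2 z.1)) => //.
  exact: (measurableT_comp mW
    (measurable_fun_pair (measurable_snd (T1 := V) (T2 := R)) measurable_fst)).
- by apply: measurable_funeM; exact/measurable_EFinP.
move=> y _.
have [y0|y0] := eqVneq (nrm y) 0%R.
  rewrite integral0_eq.
    by rewrite -EFinM lee_fin mulr_ge0 ?invr_ge0 ?mulr_ge0// ltW.
  move=> r _; rewrite /W /w y0 /ball_volume powR0; last first.
    by rewrite gt_eqF// homogeneous_dim_gt0.
  by rewrite mulr0 powR0 ?gt_eqF// mulr0 mul0r; case: ifP.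
have {}y0 : (0 < nrm y)%R by rewrite lt_neqAle eq_sym y0 qn_ge0.
have v0 := ball_volume_gt0 hs hN y0.
rewrite le_eqVlt; apply/orP; left; apply/eqP.
transitivity (\int[lam]_(t in `]nrm y, +oo[)
    ((g y * vol (nrm y) `^ s)%:E * (t `^ (Q - 1) * vol t `^ (- s - 1))%:E)).
  rewrite integral_mkcond [RHS]integral_mkcond; apply: eq_integral => t _.
  rewrite !patchE !mem_setE !in_itv/= !andbT /W.
  have [yt|ty] := ltP (nrm y) t; last by case: ifP.
  by rewrite (lt_trans y0 yt).
rewrite ge0_integralZl//; last 3 first.
- apply/measurable_EFinP; apply: measurable_funTS; apply: measurable_funM.
    exact: measurable_powR.
  exact: (measurableT_comp (measurable_powR _)).
- by move=> t _; rewrite lee_fin mulr_ge0 ?powR_ge0.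
- by rewrite lee_fin mulr_ge0 ?powR_ge0// ltW.
rewrite tail_integral// -!EFinM; congr EFin.
have := powR_gt0 s v0; move: (vol _ `^ s)%R => a /gt_eqF aN0.
by field; rewrite aN0 ?(gt_eqF s0) ?(gt_eqF sS0).
Qed.

Lemma geometric_mean_integral_le (p q : R) (u v f : V -> R) :
  (0 < p)%R -> (p <= q)%R -> positive_fun u -> positive_fun v ->
  D_const nrm sigma p q u v < +oo -> positive_fun f ->
  let g := (fun y => f y `^ p * v y)%R in
  let s := (q / p)%R in
  m.-integrable setT (EFin \o g) ->
  \int[m]_x (geometric_mean nrm f x `^ q * (u x)%:E) <=
  (fine (D_const nrm sigma p q u v) `^ q * expR s / s *
    fine (\int[m]_y (g y)%:E) `^ s)%:E.
Proof.
move=> p0 pq pu pv Doo pf g s ig.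
have q0 : (0 < q)%R by exact: lt_le_trans pq.
have s0 : (0 < s)%R by rewrite divr_gt0.
have pg : positive_fun g by exact: positive_weighted_power.
have g0 y : (0 <= g y)%R by exact/ltW/pg.2.
have sS0 := fine_sphere_gt0 hs.
pose H r := expeR (mean_qball nrm (fun y => ln (f y)) r) `^ q.
have mH : measurable_fun setT H.
  apply: (measurableT_comp (measurable_poweR _)).
  apply: (measurableT_comp measurable_expeR).
  by apply: measurable_mean_qball; exact: measurable_ln_positive.
have mEu : measurable_fun setT (EFin \o u).
  by apply/measurable_EFinP; exact: pu.1.
have u0 x : 0 <= (EFin \o u) x by rewrite lee_fin ltW// pu.2.
have H0 r : 0 <= H r by exact: poweR_ge0.
have Afin : \int[m]_y (g y)%:E \is a fin_num by apply: integrable_fin_num.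
have A0 : (0 < fine (\int[m]_y (g y)%:E))%R.
  exact: fine_integral_gt0.
rewrite [leLHS](polar_radial hs mH H0 mEu u0).
set A := fine _ in A0 *; set D := fine _.
set K := (D `^ q * sS * expR s * A `^ (s - 1))%R.
have K0 : (0 <= K)%R by rewrite !mulr_ge0 ?powR_ge0 ?expR_ge0// ltW.
have mvol : measurable_fun setT vol by exact: measurable_ball_volume.
have mwint : measurable_fun setT (wint g s).
  pose F (z : R * V) : \bar R := if (nrm z.2 < z.1)%R then
    (g z.2 * (vol (nrm z.2) * vol z.1 `^ (- 1)) `^ s)%:E else 0.
  rewrite (_ : wint g s = fun r => \int[m]_y F (r, y)).
    apply: measurable_fun_integral_ge0 => //.
      apply: measurable_fun_ifT => //.
        apply: measurable_fun_ltr => //.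
        exact: (measurableT_comp (measurable_quasi_norm nrm)).
      apply/measurable_EFinP; apply: measurable_funM.
        exact: (measurableT_comp pg.1).
      apply: (measurableT_comp (measurable_powR _)); apply: measurable_funM.
        apply: (measurableT_comp mvol).
        exact: (measurableT_comp (measurable_quasi_norm nrm)).
      apply: (measurableT_comp (measurable_powR _)).
      exact: (measurableT_comp mvol).
    move=> r y _; rewrite /F; case: ifP => // _.
    by rewrite lee_fin mulr_ge0 ?powR_ge0.
  apply/funext => r; rewrite /weighted_integral integral_mkcond.
  apply: eq_integral => y _; rewrite patchE /F /=.
  by rewrite mem_qball powR_inv1//; exact: ball_volume_ge0 hs hN r.
have wint0 r : 0 <= wint g s r.
  by apply: integral_ge0 => y _; rewrite lee_fin mulr_ge0 ?powR_ge0.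
have mtail : measurable_fun (`]0%R, +oo[ : set R)
    (fun r => (r `^ (Q - 1))%:E * ((vol r)^-1%:E * wint g s r)).
  apply: measurable_funTS; apply: emeasurable_funM.
    by apply/measurable_EFinP; exact: measurable_powR.
  apply: emeasurable_funM => //; apply/measurable_EFinP.
  rewrite (_ : (fun r => _) = fun r => vol r `^ (- 1))%R.
    exact: (measurableT_comp (measurable_powR _)).
  by apply/funext => r; rewrite powR_inv1//; exact: ball_volume_ge0 hs hN r.
have tail0 r : 0 <= (r `^ (Q - 1))%:E * ((vol r)^-1%:E * wint g s r).
  rewrite mule_ge0 ?lee_fin ?powR_ge0// mule_ge0// lee_fin invr_ge0.
  exact: ball_volume_ge0 hs hN r.
apply: (@le_trans _ _ (\int[lam]_(r in `]0%R, +oo[)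
    (K%:E * ((r `^ (Q - 1))%:E * ((vol r)^-1%:E * wint g s r))))).
  apply: ge0_le_integral => //.
  - move=> r _; rewrite mule_ge0//; last exact: integral_ge0.
    by rewrite mule_ge0// lee_fin powR_ge0.
  - apply: measurable_funTS; apply: emeasurable_funM.
      apply: emeasurable_funM => //.
      by apply/measurable_EFinP; exact: measurable_powR.
    apply: (@measurable_fun_integral_ge0 _ _ _ _ _ (sphere_measure hs) _
      (fun z : R * V => (u (dil G z.1 z.2))%:E)).
    + exact: measurable_qsphere.
    + by apply: (measurableT_comp mEu); exact: measurable_dil.
    + by move=> r y _; exact: u0.
  - exact: measurable_funeM.
  - move=> r; rewrite /= in_itv/= andbT => r0.
    rewrite [in leLHS]muleAC [in leRHS]muleCA muleC.
    rewrite lee_wpmul2l ?lee_fin ?powR_ge0//.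
    exact: (pointwise_bound hs hN p0 pq pu pv Doo pf r0 ig).
rewrite ge0_integralZl ?lee_fin//.
apply: (le_trans (lee_wpmul2l _ (hardy_tail s0 pg))); first by rewrite lee_fin.
rewrite -(fineK Afin) -/A -!EFinM lee_fin le_eqVlt; apply/orP; left; apply/eqP.
have AE : (A `^ s = A `^ (s - 1) * A)%R.
  rewrite -[X in (_ * X)%R]powRr1 ?ltW// -powRD ?subrK//.
  by rewrite (gt_eqF A0) implybT.
rewrite /K AE.
by field; rewrite ?(gt_eqF s0) ?(gt_eqF sS0).
Qed.

End main_bound.

(** * Optimal constants *)

Section optimal_constant.
Local Open Scope ereal_scope.
Context {R : realType} {N : nat} (G : homogeneous_group R N)
  (nrm : quasi_norm G).
Local Notation V := 'rV[R]_N.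
Local Notation m := (lebesgue_rV R N).
Local Notation lam := (@lebesgue_R R).
Local Notation Q := (homogeneous_dim G).
Context (sigma : {measure set V -> \bar R}) (hs : polar_measure nrm sigma)
  (hN : (0 < N)%N).
Local Notation vol := (ball_volume nrm sigma).
Local Notation S := (qsphere nrm).

Context (p q : R) (p0 : (0 < p)%R) (pq : (p <= q)%R)
  (u v : V -> R) (pu : positive_fun u) (pv : positive_fun v)
  (Doo : D_const nrm sigma p q u v < +oo).

Let q0 : (0 < q)%R. Proof. exact: lt_le_trans pq. Qed.

Lemma D_const_ge0 : 0 <= D_const nrm sigma p q u v.
Proof.
have [y0 Sy0] := qsphere_nonempty hs.
have y0N0 : y0 != 0%R.
  apply/eqP => /(qn_eq0 nrm) y00; move: Sy0; rewrite /qsphere /= y00.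
  by move/eqP; rewrite eq_sym oner_eq0.
apply: le_ereal_sup_tmp; eexists; first by exists y0.
by rewrite !mule_ge0 ?poweR_ge0.
Qed.

Lemma D_const_fin : D_const nrm sigma p q u v \is a fin_num.
Proof. by rewrite ge0_fin_numE// D_const_ge0. Qed.

Lemma measurable_geometric_mean (f : V -> R) : positive_fun f ->
  measurable_fun setT (fun x => geometric_mean nrm f x `^ q * (u x)%:E).
Proof.
move=> pf; apply: emeasurable_funM; last by apply/measurable_EFinP; exact: pu.1.
apply: (measurableT_comp (measurable_poweR _)).
apply: (measurableT_comp measurable_expeR).
apply: (measurableT_comp
  (measurable_mean_qball nrm (measurable_ln_positive pf))).
exact: measurable_quasi_norm.
Qed.

Lemma geometric_mean_integrand_ge0 (f : V -> R) x :
  0 <= geometric_mean nrm f x `^ q * (u x)%:E.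
Proof. by rewrite mule_ge0 ?poweR_ge0// lee_fin ltW// pu.2. Qed.

Lemma geometric_mean_inequality_of_le (C : R) : (0 < C)%R ->
  ((p / q) `^ q^-1 * expR p^-1 * fine (D_const nrm sigma p q u v) <= C)%R ->
  geometric_mean_inequality nrm p q u v C.
Proof.
move=> C0 leC f pf.
pose g y := (f y `^ p * v y)%R.
have pg : positive_fun g by exact: positive_weighted_power.
have Ag0 : 0 <= \int[m]_x (g x)%:E.
  by apply: integral_ge0 => y _; rewrite lee_fin ltW// pg.2.
rewrite -/g; have [Aoo|Aoo] := ltP (\int[m]_x (g x)%:E) +oo; last first.
  move: Aoo; rewrite leye_eq => /eqP ->; rewrite /= invr_eq0 gt_eqF//.
  by rewrite gt0_muley ?lte_fin// leey.
have ig : m.-integrable setT (EFin \o g).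
  apply/integrableP; split; first by apply/measurable_EFinP; exact: pg.1.
  rewrite (le_lt_trans _ Aoo)// le_eqVlt; apply/orP; left; apply/eqP.
  by apply: eq_integral => y _ /=; rewrite gtr0_norm// pg.2.
have := geometric_mean_integral_le hs hN p0 pq pu pv Doo pf ig.
rewrite -/g; have Afin : \int[m]_x (g x)%:E \is a fin_num.
  by rewrite ge0_fin_numE.
rewrite -[in X in _ -> X](fineK Afin).
have A0 : (0 <= fine (\int[m]_x (g x)%:E))%R by rewrite fine_ge0.
set A := fine _ in A0 *.
have D0 : (0 <= fine (D_const nrm sigma p q u v))%R.
  by rewrite fine_ge0// D_const_ge0.
move: leC; set D := fine _ in D0 * => leC le1.
have s0 : (0 < q / p)%R by rewrite divr_gt0.
have lhs0 : 0 <= \int[m]_x (geometric_mean nrm f x `^ q * (u x)%:E).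
  by apply: integral_ge0 => x _; exact: geometric_mean_integrand_ge0.
have qi0 : (0 <= q^-1)%R by rewrite invr_ge0 ltW.
apply: (@le_trans _ _
    ((D `^ q * expR (q / p) / (q / p) * A `^ (q / p))%:E `^ q^-1)).
  apply: gt0_ler_poweR => //.
  - by rewrite in_itv/= lhs0 leey.
  - rewrite in_itv/= leey andbT lee_fin.
    by rewrite !mulr_ge0 ?powR_ge0 ?expR_ge0 ?invr_ge0 ?(ltW s0).
rewrite /= -EFinM lee_fin.
apply: (@le_trans _ _ ((p / q) `^ q^-1 * expR p^-1 * D * A `^ p^-1)%R);
    last first.
  by rewrite ler_wpM2r// powR_ge0.
have -> : (p / q = (q / p)^-1)%R by rewrite invf_div.
set a := (D `^ q)%R; set b := expR _; set c := (_^-1)%R; set d := (A `^ _)%R.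
have a0 : (0 <= a)%R by exact: powR_ge0.
have b0 : (0 <= b)%R by exact: expR_ge0.
have c0 : (0 <= c)%R by rewrite invr_ge0 ltW.
have d0 : (0 <= d)%R by exact: powR_ge0.
rewrite (powRM _ (mulr_ge0 (mulr_ge0 a0 b0) c0) d0).
rewrite (powRM _ (mulr_ge0 a0 b0) c0).
rewrite (powRM _ a0 b0) /a /b /d -expRM -!powRrM divff ?gt_eqF// powRr1//.
have -> : (q / p / q = p^-1)%R by rewrite mulrAC divff ?gt_eqF// mul1r.
by rewrite le_eqVlt; apply/orP; left; apply/eqP; ring.
Qed.

(** Test the inequality on the constant function one, whose geometric means are
    one: the left-hand side is a positive power of the integral of [u]. *)
Lemma geometric_mean_inequality_gt0 (C : R) :
  geometric_mean_inequality nrm p q u v C -> (0 < C)%R.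
Proof.
move=> ineq; have /ineq : positive_fun (cst 1%R : V -> R).
  by split=> // x; rewrite ltr01.
have gm1 x : geometric_mean nrm (cst 1%R) x = 1.
  rewrite /geometric_mean /mean_qball.
  under eq_integral do rewrite /= ln1.
  by rewrite integral0 mule0 /= expR0.
under eq_integral do rewrite gm1 /= powR1 mul1e.
have uT : 0 < \int[m]_x (u x)%:E.
  exact: positive_integral_gt0 measurableT lebesgue_rV_gt0 pu.
rewrite ltNge; move=> le1; apply/negP => C0.
have : 0 < (\int[m]_x (u x)%:E) `^ q^-1.
  rewrite lt_neqAle poweR_ge0 andbT eq_sym poweR_eq0 ?ltW// negb_and.
  by rewrite (gt_eqF uT).
apply/negP; rewrite -leNgt (le_trans le1)// mule_le0_ge0 ?lee_fin//.
exact: poweR_ge0.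
Qed.

(** A test function for which both sides are positive and the right-hand side is
    finite.  If the supremum is positive, [ln v] is integrable on some ball
    [B(0,r)]; take [f = (g / v)^(1/p)] with [g] integrable, positive, and equal
    to one on [B(0,r)], so that the geometric means of [f] are positive
    there. *)
Lemma exists_nondegenerate_test : 0 < D_const nrm sigma p q u v ->
  exists f, [/\ positive_fun f,
    0 < \int[m]_x (geometric_mean nrm f x `^ q * (u x)%:E) &
    \int[m]_x (f x `^ p * v x)%:E < +oo].
Proof.
move=> /ereal_sup_gt[_ [x /= xN0 <-]].
set r := nrm x; have r0 : (0 < r)%R by exact: quasi_norm_gt0.
have mB := measurable_qball nrm r.
have pN0 : (p^-1 != 0)%R by rewrite invr_eq0 gt_eqF.
have [voo _] := D_const_radial_bound hs hN p0 pq pu pv Doo r0.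
rewrite /geometric_mean -/r (mean_qballE hs hN)// => prod0.
have mlnv : measurable_fun setT (EFin \o (fun y => ln (v y)^-1)).
  apply/measurable_EFinP; rewrite (ln_inv_positive pv).
  by apply: measurableT_comp => //; exact: measurable_ln_positive.
have iv : m.-integrable (qball nrm r) (fun y => (ln (v y)^-1)%:E).
  apply: integrable_of_funeneg => //; first exact: measurable_funTS.
  rewrite ltey; apply/eqP => vN; move: prod0.
  rewrite (integral_eqNy vN) gt0_muleNy ?lte_fin ?invr_gt0; last first.
    exact: (ball_volume_gt0 hs hN).
  rewrite /=.
  by rewrite powR0// mule0 ltxx.
(* the exponent makes [h t * t^(Q - 1) = t^(-2)] integrable at infinity *)
pose h (t : R) : R := if (r < t)%R then (t `^ (- 1 - Q))%R else 1%R.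
have mh : measurable_fun setT h.
  apply: measurable_fun_ifT; [|exact: measurable_powR|by []].
  by apply: measurable_fun_ltr.
pose g y := h (nrm y).
have g0 y : (0 < g y)%R.
  rewrite /g /h; case: ifP => // ry; rewrite powR_gt0//.
  exact: lt_trans ry.
have mg : measurable_fun setT g.
  by apply: (measurableT_comp mh); exact: measurable_quasi_norm.
pose f y := ((g y / v y) `^ p^-1)%R.
have v0 y : (0 < v y)%R by exact: pv.2.
have mf : measurable_fun setT f.
  apply: (measurableT_comp (measurable_powR _)).
  rewrite (_ : (fun y => _) = (fun y => g y * v y `^ (- 1))%R).
    apply: measurable_funM => //.
    exact: (measurableT_comp (measurable_powR _) pv.1).
  by apply/funext => y; rewrite powR_inv1// ltW.
have f0 y : (0 < f y)%R by rewrite powR_gt0 ?divr_gt0.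
exists f; split=> //.
- have gm0 y : qball nrm r y -> 0 < geometric_mean nrm f y.
    move=> yr; rewrite /geometric_mean /mean_qball.
    have le_yr : qball nrm (nrm y) `<=` qball nrm r.
      by move=> z; rewrite /qball /= => /lt_trans; apply.
    have iv' : m.-integrable (qball nrm (nrm y)) (fun z => (ln (v z)^-1)%:E).
      by apply: integrableS iv => //; exact: measurable_qball.
    have : \int[m]_(z in qball nrm (nrm y)) (ln (f z))%:E =
        (p^-1)%:E * \int[m]_(z in qball nrm (nrm y)) (ln (v z)^-1)%:E.
      rewrite -(integralZl (measurable_qball nrm _) iv').
      apply: eq_integral => z /[!inE] /le_yr zr.
      rewrite -EFinM /f ln_powR /g /h ltNge ltW//=.
      by rewrite div1r.
    have vfin : \int[m]_(z in qball nrm (nrm y)) (ln (v z)^-1)%:E \is a fin_num.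
      by apply: integrable_fin_num => //; exact: measurable_qball.
    move=> ->.
    by rewrite -(fineK vfin) -!EFinM /= lte_fin expR_gt0.
  apply: (@lt_le_trans _ _ (\int[m]_(y in qball nrm r)
      (geometric_mean nrm f y `^ q * (u y)%:E))).
    apply: integral_gt0 => //.
    + by apply: measurable_funTS; exact: measurable_geometric_mean.
    + move=> y yr; rewrite mule_gt0 ?lte_fin ?pu.2//.
      rewrite lt_neqAle poweR_ge0 andbT eq_sym poweR_eq0 ?ltW ?gm0//.
      by rewrite negb_and (gt_eqF (gm0 _ yr)).
    + have := ball_volume_gt0 hs hN r0.
      by rewrite -lte_fin -(measure_qball hs hN r0).
  apply: ge0_subset_integral => //.
    exact: measurable_geometric_mean.
  by move=> y _; exact: geometric_mean_integrand_ge0.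
- have -> : \int[m]_y (f y `^ p * v y)%:E = \int[m]_y (EFin \o h) (nrm y).
    apply: eq_integral => y _; rewrite /f -powRrM mulVf ?gt_eqF//.
    by rewrite powRr1 ?divr_ge0 ?ltW// divfK// gt_eqF.
  have h0 t : (0 <= (EFin \o h) t).
    by rewrite lee_fin /h; case: ifP => // _; rewrite powR_ge0.
  rewrite (polar_radial1 hs)//; last exact/measurable_EFinP.
  have sSfin := sphere_measure_fin hs.
  rewrite lte_mul_pinfty//.
  pose a (t : R) : \bar R := (t `^ (Q - 1))%:E.
  pose b (t : R) : \bar R := (t `^ (- 1 - 1))%:E.
  have ma : measurable_fun setT a.
    by apply/measurable_EFinP; exact: measurable_powR.
  have mb : measurable_fun setT b.
    by apply/measurable_EFinP; exact: measurable_powR.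
  have mI1 : measurable (`]0%R, (r + 1)%R[ : set R) by exact: measurable_itv.
  have mI2 : measurable (`]r, +oo[ : set R) by exact: measurable_itv.
  have mI : measurable (`]0%R, +oo[ : set R) by exact: measurable_itv.
  have ma1 : measurable_fun setT (a \_ `]0%R, (r + 1)%R[).
    by apply/(measurable_restrictT a mI1); exact: measurable_funTS.
  have mb1 : measurable_fun setT (b \_ `]r, +oo[).
    by apply/(measurable_restrictT b mI2); exact: measurable_funTS.
  have a10 t : 0 <= (a \_ `]0%R, (r + 1)%R[) t.
    by apply: erestrict_ge0 => ? _; rewrite lee_fin powR_ge0.
  have b10 t : 0 <= (b \_ `]r, +oo[) t.
    by apply: erestrict_ge0 => ? _; rewrite lee_fin powR_ge0.
  apply: (@le_lt_trans _ _ (\int[lam]_t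
      ((a \_ `]0%R, (r + 1)%R[) t + (b \_ `]r, +oo[) t))); last first.
    rewrite ge0_integralD// -!integral_mkcond.
    rewrite integral_powR_itv0 ?(homogeneous_dim_gt0 G hN) ?addr_gt0//.
    by rewrite integral_powR_itvy ?ltr01// -EFinD ltry.
  rewrite integral_mkcond; apply: ge0_le_integral => //.
  - move=> t _; apply: erestrict_ge0 => ? _.
    by rewrite mule_ge0// lee_fin powR_ge0.
  - apply/(measurable_restrictT _ mI); apply: measurable_funTS.
    by apply: emeasurable_funM => //; exact/measurable_EFinP.
  - exact: emeasurable_funD.
  move=> t _; rewrite [leLHS]patchE mem_setE in_itv/= andbT.
  case: ifPn => t0; last exact: adde_ge0.
  rewrite !patchE !mem_setE !in_itv/= t0/= andbT /h /a /b.
  have [rt|tr] := ltP r t.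
    rewrite -EFinM -powRD; last by rewrite (gt_eqF t0) implybT.
    have -> : (- 1 - Q + (Q - 1) = - 1 - 1)%R by ring.
    by rewrite leeDr//; case: ifP => // _; rewrite lee_fin powR_ge0.
  by rewrite (le_lt_trans tr) ?ltrDl// mul1e adde0.
Qed.

(** The infimum of the admissible constants is admissible as soon as it is
    positive, and the test function above bounds it away from zero.  Positivity
    matters: when the right-hand integral is infinite, a zero constant would
    make the right-hand side vanish. *)
Lemma exists_optimal_constant : 0 < D_const nrm sigma p q u v ->
  exists C, optimal_constant nrm p q u v C.
Proof.
move=> D0; have [f0 [pf0 lhs0 A0oo]] := exists_nondegenerate_test D0.
pose E := [set C | geometric_mean_inequality nrm p q u v C].
pose C1 := ((p / q) `^ q^-1 * expR p^-1 * fine (D_const nrm sigma p q u v))%R.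
have C10 : (0 < C1)%R.
  rewrite !mulr_gt0 ?powR_gt0 ?expR_gt0 ?divr_gt0// fine_gt0// D0/=.
  by rewrite -ge0_fin_numE ?D_const_fin// ltW.
have E1 : E C1 by apply: geometric_mean_inequality_of_le.
have E0 : lbound E 0%R by move=> C /geometric_mean_inequality_gt0/ltW.
have hE : has_lbound E by exists 0%R.
have bound f : positive_fun f ->
    \int[m]_x (f x `^ p * v x)%:E < +oo ->
    exists L A : R, [/\ (0 < A)%R,
      (\int[m]_x (geometric_mean nrm f x `^ q * (u x)%:E)) `^ q^-1 = L%:E,
      (\int[m]_x (f x `^ p * v x)%:E) `^ p^-1 = A%:E &
      lbound E (L / A)%R].
  move=> pf Aoo.
  have Ag0 := positive_integral_gt0 measurableT lebesgue_rV_gt0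
    (positive_weighted_power p pf pv).
  have Afin : \int[m]_x (f x `^ p * v x)%:E \is a fin_num.
    by rewrite ge0_fin_numE ?ltW.
  have AE : (\int[m]_x (f x `^ p * v x)%:E) `^ p^-1 =
      (fine (\int[m]_x (f x `^ p * v x)%:E) `^ p^-1)%:E.
    by rewrite -[in LHS](fineK Afin).
  have A0 : (0 < fine (\int[m]_x (f x `^ p * v x)%:E) `^ p^-1)%R.
    by rewrite powR_gt0// fine_gt0// Ag0.
  have lhs_fin : (\int[m]_x (geometric_mean nrm f x `^ q * (u x)%:E)) `^ q^-1
      \is a fin_num.
    rewrite ge0_fin_numE ?poweR_ge0//.
    by apply: le_lt_trans (E1 _ pf) _; rewrite AE -EFinM ltry.
  exists (fine
    ((\int[m]_x (geometric_mean nrm f x `^ q * (u x)%:E)) `^ q^-1)).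
  exists (fine (\int[m]_x (f x `^ p * v x)%:E) `^ p^-1)%R.
  split=> //; first by rewrite fineK.
  move=> C EC; rewrite ler_pdivrMr// -lee_fin fineK// EFinM -AE.
  exact: EC.
have [L0 [A0 [A00 L0E A0E lb0]]] := bound _ pf0 A0oo.
have L00 : (0 < L0)%R.
  rewrite -lte_fin -L0E lt_neqAle poweR_ge0 andbT eq_sym poweR_eq0 ?ltW//.
  by rewrite negb_and (gt_eqF lhs0).
have iE0 : (0 < inf E)%R.
  apply: (@lt_le_trans _ _ (L0 / A0)%R); first by rewrite divr_gt0.
  by apply: lb_le_inf => //; exists C1.
exists (inf E); split; last by move=> C EC; exact: ge_inf.
move=> f pf.
have [Aoo|Aoo] := ltP (\int[m]_x (f x `^ p * v x)%:E) +oo; last first.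
  move: Aoo; rewrite leye_eq => /eqP ->; rewrite /= invr_eq0 gt_eqF//.
  by rewrite gt0_muley ?lte_fin// leey.
have [L [A [A0' -> -> lb]]] := bound _ pf Aoo.
rewrite -EFinM lee_fin -ler_pdivrMr//.
by apply: lb_le_inf => //; exists C1.
Qed.

End optimal_constant.

Theorem theorem1p4 (R : realType) (N : nat) (hN : (0 < N)%N)
  (G : homogeneous_group R N) (nrm : quasi_norm G)
  (sigma : {measure set 'rV[R]_N -> \bar R}) (hsigma : polar_measure nrm sigma)
  (p q : R) (hp : 0 < p) (hpq : p <= q)
  (u v : 'rV[R]_N -> R) (hu : positive_fun u) (hv : positive_fun v)
  (hD : (D_const nrm sigma p q u v < +oo)%E) :
  [/\ exists2 C : R, 0 < C & geometric_mean_inequality nrm p q u v C,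
      (0 < D_const nrm sigma p q u v)%E ->
        exists C : R, optimal_constant nrm p q u v C &
      forall C : R, optimal_constant nrm p q u v C ->
        0 < C /\
        (C%:E <= ((p / q) `^ q^-1 * expR p^-1)%:E *
                 D_const nrm sigma p q u v)%E].
Proof.
have Dfin := D_const_fin hsigma hD.
have D0 : 0 <= fine (D_const nrm sigma p q u v).
  by rewrite fine_ge0 ?(D_const_ge0 hsigma).
have le_bound := geometric_mean_inequality_of_le hsigma hN hp hpq hu hv hD.
set b := (p / q) `^ q^-1 * expR p^-1.
have bD0 : 0 <= b * fine (D_const nrm sigma p q u v).
  by rewrite !mulr_ge0 ?powR_ge0 ?expR_ge0.
(* when [D_const] is zero so is the bound, which is then not admissible *)
have slack e : 0 < e -> geometric_mean_inequality nrm p q u v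
    (b * fine (D_const nrm sigma p q u v) + e).
  by move=> e0; apply: le_bound; rewrite ?ltr_wpDl// lerDl ltW.
split.
- exists (b * fine (D_const nrm sigma p q u v) + 1).
    by rewrite ltr_wpDl.
  exact: slack.
- exact: (exists_optimal_constant hsigma hN hp hpq hu hv hD).
- move=> C [ineqC minC]; split.
    exact: (geometric_mean_inequality_gt0 hu ineqC).
  rewrite -(fineK Dfin) -EFinM lee_fin.
  by apply/ler_addgt0Pr => e /slack; exact: minC.
Qed.
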